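(* Let $p,q,r,x,y,z\in\mathbb{Z}$ with $\gcd(x,y,z)=1$, $x,y,z\ge 2$ and $p,q,r\ge 3$, and suppose that $$x^p+y^q=z^r.$$ Let $G=G(x,y,z)=\prod_{\ell\mid xyz,\ \ell\text{ prime}}\ell$ be the radical of $xyz$. Then $$\frac{3\,\log\log(z^r)}{\log(z^r)}\cdot\frac{1}{1+\dfrac{45}{\log\log(G)}}<\frac1p+\frac1q+\frac1r .$$ Equivalently, the equation $x^p+y^q=z^r$ has no solutions in integers $p,q,r,x,y,z$ with $\gcd(x,y,z)=1$, $x,y,z\ge 2$ and $p,q,r\ge 3$ for which $$\frac1p+\frac1q+\frac1r\le\frac{3\,\log\log(z^r)}{\log(z^r)}\cdot\frac{1}{1+\dfrac{45}{\log\log(G)}} .$$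
   Context: Here $\log$ denotes the natural logarithm, and $G(x,y,z)$ denotes the greatest square-free factor (radical) of $xyz$, i.e. the product of the distinct primes dividing $xyz$. *)

(* Defs.v *)
From HB Require Import structures.
From mathcomp Require Import all_boot all_order all_algebra.

Set Implicit Arguments.
Unset Strict Implicit.
Unset Printing Implicit Defensive.

Definition radical (n : int) : nat := (\prod_(l <- primes `|n|) l)%N.

(* Main.v *)
(* Write H = z^r. Since x^p, y^q < H, the sum 1/p + 1/q + 1/r exceeds
   log(xyz) / log H, so it suffices to bound log log H by u/3 + 15 u / log u with
   u = log(xyz), that is, log H by (xyz)^(1/3) up to a factor exp(15 u / log u).

   This follows from lower bounds for linear forms in two logarithms, proved by
   Laurent's interpolation determinants. If a1^b1 and a2^b2 are close (l-adically
   or in absolute value), then at the points r b2 + s b1 the numbers a1^r a2^s are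
   close to values of an exponential function, so the integer determinant of the
   functions X^k Y^l at such points is divisible by a high power of l,
   respectively small; a zero estimate provides points where it does not vanish.
   For l-adic closeness the points are taken in one residue class mod l, which
   makes the bound linear in l.

   If x^p or y^q is at most sqrt H, the archimedean bound applies to the other two
   terms. Otherwise let w be the least of x, y, z, so that w <= (xyz)^(1/3), and let
   l be a prime factor of w: the power of w in the equation is at least sqrt H and
   divides the difference of the squares of the other two terms, and the l-adic
   bound with l <= w gives the exponent 1/3. *)

Require Import Defs.
From HB Require Import structures.
From mathcomp Require Import all_boot all_order all_algebra.
From mathcomp Require Import all_fingroup all_solvable.
From mathcomp Require Import all_classical all_reals all_analysis.
From mathcomp Require Import zify ring lra.

Set Implicit Arguments.
Unset Strict Implicit.
Unset Printing Implicit Defensive.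

Import Order.TTheory GRing.Theory Num.Theory.
Import numFieldNormedType.Exports.
Local Open Scope ring_scope.

(** * Determinants of matrices whose rows are sums, and a weight count *)

(** Multilinearity picks one summand [phi i] for each row; a choice that is not injective repeats a
    row and contributes 0. *)
Lemma det_sum_expand (A : comNzRingType) (N : nat) (I : finType)
    (c : 'I_N -> I -> A) (v : I -> 'I_N -> A) :
  \det (\matrix_(i, j) \sum_n c i n * v n j) =
  \sum_(phi : {ffun 'I_N -> I} | injectiveb phi)
     (\prod_i c i (phi i)) * \det (\matrix_(i, j) v (phi i) j).
Proof.
transitivity (\sum_(phi : {ffun 'I_N -> I})
     (\prod_i c i (phi i)) * \det (\matrix_(i, j) v (phi i) j)).
  transitivity (\sum_(s : 'S_N) \sum_(phi : {ffun 'I_N -> I})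
      (-1) ^+ s * ((\prod_i c i (phi i)) * \prod_i v (phi i) (s i))).
    apply: eq_bigr => s _.
    under eq_bigr => i _ do rewrite mxE.
    rewrite bigA_distr_bigA big_distrr /=; apply: eq_bigr => phi _.
    by rewrite -big_split.
  rewrite exchange_big /=; apply: eq_bigr => phi _.
  rewrite /determinant big_distrr /=; apply: eq_bigr => s _.
  by rewrite mulrCA; congr (_ * (_ * _)); apply: eq_bigr => i _; rewrite mxE.
rewrite (bigID (fun phi : {ffun 'I_N -> I} => injectiveb phi)) /=.
rewrite [X in _ + X]big1 ?addr0 // => phi /injectivePn [i [j ij eqij]].
rewrite (determinant_alternate ij) ?mulr0 // => k.
by rewrite !mxE eqij.
Qed.

(** Sorted increasingly, distinct indices have weights at least 0, 1, ..., N - 1. The proof counts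
    the pairs [(m, i)] with [m < w (phi i)] in both orders. *)
Lemma weight_sum_ge (N : nat) (I : finType) (w : I -> nat) (phi : 'I_N -> I) :
  injective phi ->
  (forall m, m < N -> #|[pred n | w n <= m]| <= m.+1)%N ->
  ('C(N, 2) <= \sum_i w (phi i))%N.
Proof.
move=> inj_phi hw.
have hmin i : (\sum_(m < N) (m < w (phi i)) <= w (phi i))%N.
  rewrite -big_mkcond /= sum1_card -[leqRHS]card_ord.
  have [lt_wN|le_Nw] := ltnP (w (phi i)) N; last first.
    by rewrite (leq_trans (max_card _)) // !card_ord.
  pose f (k : 'I_(w (phi i))) : 'I_N := widen_ord (ltnW lt_wN) k.
  rewrite -(card_imset _ (_ : injective f)); last first.
    by move=> a b /(congr1 val) /= /val_inj.
  apply: subset_leq_card; apply/fintype.subsetP => m hm.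
  by apply/imsetP; exists (Ordinal hm) => //; apply: val_inj.
have hcol (m : 'I_N) : (N - m.+1 <= \sum_i (m < w (phi i)))%N.
  rewrite -big_mkcond /= sum1_card leq_subLR.
  rewrite -{1}[N]card_ord -(cardC [pred i | w (phi i) <= m]%N).
  apply: leq_add.
    apply: leq_trans (hw m (ltn_ord m)).
    rewrite -(card_imset _ inj_phi); apply: subset_leq_card.
    by apply/fintype.subsetP => n /imsetP [i hi ->].
  by apply: subset_leq_card; apply/fintype.subsetP => i; rewrite !inE -ltnNge.
have <- : (\sum_(m < N) (N - m.+1) = 'C(N, 2))%N.
  rewrite (reindex_inj rev_ord_inj) /= -bin2_sum big_mkord.
  by apply: eq_bigr => i _; rewrite subnSK // subKn ?(ltnW (ltn_ord i)).
apply: (@leq_trans (\sum_i \sum_(m < N) (m < w (phi i)))%N); last first.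
  by apply: leq_sum => i _; apply: hmin.
by rewrite exchange_big /=; apply: leq_sum => m _; apply: hcol.
Qed.

Lemma card_weight_sum (T N m : nat) : (m < N)%N ->
  (#|[pred n : 'I_T + 'I_N | (if n is inl k then k : nat else N) <= m]| <= m.+1)%N.
Proof.
move=> hm.
pose f (n : 'I_T + 'I_N) : 'I_m.+1 := if n is inl k then inord k else ord0.
rewrite -[leqRHS]card_ord -(card_in_imset (_ : {in _ &, injective f})).
  exact: max_card.
move=> [a|a] [b|b]; rewrite !inE /= ?(leqNgt N) ?hm // => ha hb.
by move/(congr1 val); rewrite /= !inordK // => /val_inj ->.
Qed.


(** * The zero estimate and the choice of interpolation points *)

Lemma coefM_top (A : comNzRingType) (p q : {poly A}) (a b : nat) :
  (size p <= a.+1)%N -> (size q <= b.+1)%N -> (p * q)`_(a + b) = p`_a * q`_b.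
Proof.
move=> hp hq; rewrite coefM.
rewrite (bigD1 (inord a : 'I_(a + b).+1)) //= inordK ?ltnS ?leq_addr // addKn.
rewrite big1 ?addr0 // => i /eqP hi.
have [lt_ai|le_ia] := ltnP a i; first by rewrite nth_default ?mul0r ?(leq_trans hp).
rewrite [X in _ * X]nth_default ?mulr0 // (leq_trans hq) //.
have: (i : nat) <> a by move=> e; apply: hi; apply: val_inj; rewrite /= inordK ?ltnS ?leq_addr.
by have := ltn_ord i; lia.
Qed.

Lemma coef_prod_top (A : comNzRingType) (I : finType) (f : I -> {poly A}) (d : I -> nat) :
  (forall i, size (f i) <= (d i).+1)%N ->
  (size (\prod_i f i)%R <= (\sum_i d i).+1)%N /\
  (\prod_i f i)`_(\sum_i d i)%N = \prod_i (f i)`_(d i).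
Proof.
move=> hf; elim/big_rec3: _ => [|i c n p _ [hs hc]]; first by rewrite size_poly1 coefC.
split; last by rewrite coefM_top // hc.
have := size_polyMleq (f i) p; have := hf i; move: hs; lia.
Qed.

Lemma coef_det_top (A : comNzRingType) (n : nat) (M : 'M[{poly A}]_n) (d : 'I_n -> nat) :
  (forall i j, size (M i j) <= (d j).+1)%N ->
  (size (\det M) <= (\sum_j d j).+1)%N /\
  (\det M)`_(\sum_j d j)%N = \det (\matrix_(i, j) (M i j)`_(d j)).
Proof.
move=> hM.
have hsum (s : 'S_n) : (\sum_j d j = \sum_i d (s i))%N by rewrite (reindex_inj (@perm_inj _ s)).
have hs (s : 'S_n) := coef_prod_top (fun i => hM i (s i)).
have sgnE (s : 'S_n) : ((-1) ^+ s : {poly A}) = ((-1) ^+ s)%:P by rewrite rmorphXn rmorphN rmorph1.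
split.
  apply: leq_trans (size_sum _ _ _) _; apply/bigmax_leqP => s _.
  rewrite sgnE mul_polyC; apply: leq_trans (size_scale_leq _ _) _.
  by rewrite (hsum s); case: (hs s).
rewrite coef_sum; apply: eq_bigr => s _.
rewrite sgnE coefCM (hsum s); case: (hs s) => _ ->; congr (_ * _).
by apply: eq_bigr => i _; rewrite mxE.
Qed.

(** The [P l] are the coefficients of a polynomial in two variables, by powers of Y. Were one of
    them nonzero, a determinant of translates, a nonzero polynomial of degree at most [K * L], would
    vanish at all the [m] points [xB i]. *)
Lemma zero_estimate (F : fieldType) (K L m : nat)
    (xA yA : 'I_L -> F) (xB yB : 'I_m -> F) (P : 'I_L -> {poly F}) :
  injective yA -> injective xB -> (forall i, yB i != 0) ->
  (forall l, size (P l) <= K.+1)%N -> (K * L < m)%N ->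
  (forall j i, \sum_l (P l).[xA j + xB i] * (yA j * yB i) ^+ l = 0) ->
  forall l, P l = 0.
Proof.
move=> inj_y inj_x yB0 sP ltKL hP l0.
apply/eqP.
apply: contraT => Pl0.
(* A column with [P l = 0] would kill the determinant [M] below, so it is
   replaced by 1 and given weight 0 in the kernel vector. *)
pose Q l := if P l == 0 then 1 else P l.
have Q0 l : Q l != 0 by rewrite /Q; case: ifPn => // _; apply: oner_neq0.
pose M : 'M[{poly F}]_L := \matrix_(j, l) (yA j ^+ l *: (Q l \Po ('X + (xA j)%:P))).
have sQ l : (size (Q l) <= K.+1)%N.
  by rewrite /Q; case: eqP; rewrite ?size_poly1 ?sP.
have hM j l : (size (M j l) <= (size (Q l)).-1.+1)%N.
  rewrite mxE (leq_trans (size_scale_leq _ _)) //.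
  by rewrite size_comp_poly2 ?size_XaddC // leqSpred.
have [sD cD] := coef_det_top hM.
(* The top coefficient is a Vandermonde determinant in the distinct [yA j] times the product of the
   leading coefficients of the [Q l]. *)
have D0 : \det M != 0.
  apply: contraNneq (_ : (\det M)`_(\sum_j (size (Q j)).-1)%N != 0) => [->|].
    by rewrite coef0.
  rewrite cD.
  have -> : (\matrix_(i, j) (M i j)`_((size (Q j)).-1)) =
      (Vandermonde L (\row_j yA j))^T *m diag_mx (\row_l lead_coef (Q l)).
    apply/matrixP => i j; rewrite mul_mx_diag !mxE coefZ; congr (_ * _).
    have sX : (1 < size ('X + (xA i)%:P)%R)%N by rewrite size_XaddC.
    have := lead_coef_comp (Q j) sX.
    rewrite lead_coefXaddC expr1n mulr1 => <-.
    by rewrite lead_coefE size_comp_poly2 // size_XaddC.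
  rewrite det_mulmx det_tr det_Vandermonde det_diag mulf_neq0 //.
    apply/prodf_neq0 => i _; apply/prodf_neq0 => j ltij; rewrite !mxE subr_eq0.
    by apply: contraTneq ltij => /inj_y ->; rewrite ltnn.
  by apply/prodf_neq0 => i _; rewrite mxE lead_coef_eq0.
(* At [xB i] the powers of [yB i], set to 0 where [P l = 0], form a kernel vector; its entry at [l0]
   is nonzero. *)
have rootD i : root (\det M) (xB i).
  rewrite /root -horner_evalE -det_map_mx; apply/eqP/eqP.
  rewrite -det_tr; apply/det0P.
  exists (\row_l (if P l == 0 then 0 else yB i ^+ l)).
    apply/eqP => /rowP /(_ l0); rewrite !mxE (negPf Pl0) => /eqP.
    by rewrite expf_eq0 (negPf (yB0 i)) andbF.
  apply/rowP => j; rewrite !mxE -[RHS](hP j i); apply: eq_bigr => l _.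
  rewrite !mxE /= horner_evalE hornerZ horner_comp !hornerE /Q.
  case: eqP => [->|_] /=; first by rewrite !mul0r horner0 mul0r.
  by rewrite exprMn [xB i + _]addrC [RHS]mulrC [X in _ = X * _]mulrC.
have : all (root (\det M)) [seq xB i | i <- enum 'I_m].
  by apply/allP => _ /mapP [i _ ->].
move/(max_poly_roots D0) => /(_ _).
rewrite map_inj_uniq ?enum_uniq // size_map size_enum_ord => /(_ isT) lt_m.
suff h : (\sum_j (size (Q j)).-1 <= K * L)%N.
  by move: (leq_trans lt_m sD); rewrite ltnS => h2; move: (leq_trans h2 h); rewrite leqNgt ltKL.
rewrite mulnC -[X in (X * _)%N]card_ord -sum_nat_const; apply: leq_sum => l _.
by have := sQ l; lia.
Qed.

(** By the zero estimate the rows of values of the monomials at all the points are linearly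
    independent; a matrix of full row rank has a nonsingular square block of columns, selected by
    [f]. The map [e] enumerates the monomials. *)
Lemma interpolation_points (K L m : nat)
    (xA yA : 'I_L -> nat) (xB yB : 'I_m -> nat) :
  (0 < K)%N -> injective yA -> injective xB -> (forall i, 0 < yB i)%N ->
  (K.-1 * L < m)%N ->
  exists (e : 'I_(K * L) -> 'I_K * 'I_L) (f : 'I_(K * L) -> 'I_L * 'I_m),
  \det (\matrix_(i, j)
     ((xA (f j).1 + xB (f j).2)%N%:Z ^+ (e i).1 *
      (yA (f j).1 * yB (f j).2)%N%:Z ^+ (e i).2)) != 0.
Proof.
move=> K0 inj_y inj_x yB0 ltKL.
have cKL : #|{: 'I_K * 'I_L}| = (K * L)%N by rewrite card_prod !card_ord.
pose e i := enum_val (cast_ord (esym cKL) i) : 'I_K * 'I_L.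
pose e' p := cast_ord cKL (enum_rank p).
have eK : cancel e e' by move=> i; rewrite /e' enum_valK cast_ordKV.
have e'K : cancel e' e by move=> p; rewrite /e /e' cast_ordK enum_rankK.
pose ent (p : 'I_K * 'I_L) (t : 'I_L * 'I_m) : int :=
  (xA t.1 + xB t.2)%N%:Z ^+ p.1 * (yA t.1 * yB t.2)%N%:Z ^+ p.2.
pose B : 'M[rat]_(K * L, #|{: 'I_L * 'I_m}|) :=
  \matrix_(i, t) (ent (e i) (enum_val t))%:~R.
have freeB : row_free B.
  apply: inj_row_free => u uB0.
  pose P l := \poly_(k < K) (if insub k is Some k' then u 0 (e' (k', l)) else 0).
  have P0 l : P l = 0.
    apply: (@zero_estimate _ K.-1 L m (fun j => (xA j)%:R) (fun j => (yA j)%:R)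
       (fun j => (xB j)%:R) (fun j => (yB j)%:R)).
    - by move=> a b /eqP; rewrite eqr_nat => /eqP /inj_y.
    - by move=> a b /eqP; rewrite eqr_nat => /eqP /inj_x.
    - by move=> i; rewrite pnatr_eq0 -lt0n.
    - by move=> l'; rewrite prednK // size_poly.
    - by [].
    move=> j i; transitivity ((u *m B) 0 (enum_rank (j, i))); last by rewrite uB0 mxE.
    rewrite [RHS]mxE.
    transitivity (\sum_k \sum_l u 0 (e' (k, l)) * B (e' (k, l)) (enum_rank (j, i))).
      rewrite [RHS]exchange_big /= ; apply: eq_bigr => l' _.
      rewrite horner_poly big_distrl /=; apply: eq_bigr => k _.
      rewrite valK mxE e'K enum_rankK /ent /= rmorphM !rmorphXn /= -mulrA.
      by rewrite -!pmulrn natrD natrM.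
    rewrite pair_bigA [RHS](reindex e') /=; last by exists e => k _; [apply: e'K | apply: eK].
    by apply: eq_bigr => -[].
  apply/rowP => i; rewrite mxE -[i]eK; case: (e i) => k l.
  by have := P0 l => /polyP /(_ k); rewrite coef_poly ltn_ord valK coef0.
have fullB : row_full B^T by rewrite /row_full mxrank_tr.
exists e, (fun j => enum_val (fullrankfun fullB j)).
have := mxrank_fullrowsub fullB; set C := rowsub _ _ => rC.
have uC : C \in unitmx by rewrite -row_free_unit /row_free rC.
move: uC; rewrite unitmxE unitfE -det_tr => detC.
apply: contraNneq detC => det0.
rewrite [X in \det X](_ : _ = map_mx intr (\matrix_(i, j) ent (e i) (enum_val (fullrankfun fullB j)))).
  by rewrite det_map_mx det0.
by apply/matrixP => i j; rewrite !mxE.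
Qed.

(** * Divisibility of interpolation determinants by powers of [l] *)

(** Multiplication by [l * u] preserves the shape of the sum, because u * C(u, m) = m * C(u, m) + (m
    + 1) * C(u, m + 1): the index rises by at most one, and the new factor [l] supplies the power
    that the shifted index needs. *)
Lemma padic_binomial_expansion (l t : int) (T k : nat) :
  exists d : nat -> int, forall u, (u < T)%N ->
  l ^+ k * u%:Z ^+ k * (1 + l * t) ^+ u = \sum_(m < T) d m * l ^+ m * 'C(u, m)%:Z.
Proof.
elim: k => [|k [d hd]].
  exists (fun m => t ^+ m) => u ltuT.
  rewrite !expr0 !mul1r exprDn.
  rewrite (big_ord_widen_cond T predT (fun i => 1 ^+ (u - i) * (l * t) ^+ i *+ 'C(u, i))) //=.
  rewrite big_mkcond /=; apply: eq_bigr => i _; rewrite ltnS.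
  case: leqP => [_|lt_ui]; last by rewrite bin_small // mulr0.
  by rewrite expr1n mul1r exprMn -mulr_natr natz [t ^+ _ * _]mulrC.
exists (fun m => l * m%:Z * d m + m%:Z * d m.-1) => u ltuT.
have -> : l ^+ k.+1 * u%:Z ^+ k.+1 * (1 + l * t) ^+ u =
    l * u%:Z * (l ^+ k * u%:Z ^+ k * (1 + l * t) ^+ u) by rewrite !exprS; ring.
rewrite hd // big_distrr /=.
have step m : l * u%:Z * (d m * l ^+ m * 'C(u, m)%:Z) =
    l * m%:Z * d m * l ^+ m * 'C(u, m)%:Z + m.+1%:Z * d m * l ^+ m.+1 * 'C(u, m.+1)%:Z.
  have e : u%:Z * 'C(u, m)%:Z = m%:Z * 'C(u, m)%:Z + m.+1%:Z * 'C(u, m.+1)%:Z.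
    rewrite -!PoszM -PoszD; congr Posz.
    have [le_mu|lt_um] := leqP m u; last by rewrite !bin_small // ?(leq_trans lt_um) // !muln0.
    by rewrite mul_bin_left -mulnDl subnKC.
  transitivity (l * d m * l ^+ m * (u%:Z * 'C(u, m)%:Z)); first by ring.
  by rewrite e exprS; ring.
under eq_bigr => m _ do rewrite step.
under [RHS]eq_bigr => m _ do rewrite 2!mulrDl.
rewrite !big_split /=; congr (_ + _).
case: T ltuT {hd} => // T ltuT.
rewrite [LHS]big_ord_recr [RHS]big_ord_recl /= bin_small // !mulr0 addr0 !mul0r add0r.
by apply: eq_bigr.
Qed.

(** Multiplying each row by [l ^+ K] provides the powers of [l] that [padic_binomial_expansion]
    requires. Every row is then a combination of functions whose coefficients are divisible by [l]
    to their weight, and the [N] rows use distinct functions. *)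
Lemma padic_det_dvd (N K L : nat) (l t kappa : int) (u : 'I_N -> nat) (y : 'I_N -> int)
    (e : 'I_N -> 'I_K * 'I_L) :
  (forall j, (l ^+ N %| y j - kappa * (1 + l * t) ^+ u j)%Z) ->
  (l ^+ 'C(N, 2) %| l ^+ (N * K) *
     \det (\matrix_(i, j) ((u j)%:Z ^+ (e i).1 * y j ^+ (e i).2)))%Z.
Proof.
move=> hy.
pose T := (\max_j u j).+1.
have hT j : (u j < T)%N by rewrite ltnS; apply: leq_bigmax.
(* The powers of [1 + l * t] have the same shape, so the expansion also covers the powers of the
   [y j]. *)
have [t' ht'] : exists t' : nat -> int, forall n, (1 + l * t) ^+ n = 1 + l * t' n.
  exists (fun n => t * (\sum_(i < n) (1 + l * t) ^+ i)) => n.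
  set z := 1 + l * t; have -> : l * (t * (\sum_(i < n) z ^+ i)) = (z - 1) * \sum_(i < n) z ^+ i.
    by rewrite /z; ring.
  by rewrite -subrX1; ring.
have [d hd] := fin_all_exists (fun i => padic_binomial_expansion l (t' (e i).2) T (e i).1).
have hE i j : exists r, y j ^+ (e i).2 =
    kappa ^+ (e i).2 * (1 + l * t' (e i).2) ^+ u j + l ^+ N * r.
  have /dvdzP [q hq] := hy j.
  exists (q * (\sum_(a < (e i).2) y j ^+ ((e i).2.-1 - a) * (kappa * (1 + l * t) ^+ u j) ^+ a)).
  rewrite -ht' mulrA [l ^+ N * q]mulrC -hq -subrXX exprMn -!exprM [(u j * _)%N]mulnC.
  by rewrite addrC subrK.
have [r hr] := fin_all_exists (fun i => fin_all_exists (hE i)).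
(* The congruence errors are treated as [N] additional interpolation functions
   of weight [N], so that they cost nothing in [weight_sum_ge]. *)
pose w (n : 'I_T + 'I_N) := if n is inl k then k : nat else N.
pose c i (n : 'I_T + 'I_N) : int := match n with
  | inl m => l ^+ (K - (e i).1) * kappa ^+ (e i).2 * d i m
  | inr i' => (i == i')%:R * l ^+ K end.
pose v (n : 'I_T + 'I_N) j : int := match n with
  | inl m => 'C(u j, m)%:Z
  | inr i => (u j)%:Z ^+ (e i).1 * r i j end.
rewrite mulnC exprM -detZ.
rewrite [X in \det X](_ : _ = \matrix_(i, j) \sum_n (l ^+ w n * c i n) * v n j); last first.
  apply/matrixP => i j; rewrite !mxE big_sumType /= hr.
  have -> : \sum_i' l ^+ N * ((i == i')%:R * l ^+ K) * ((u j)%:Z ^+ (e i').1 * r i' j) =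
      l ^+ N * l ^+ K * (u j)%:Z ^+ (e i).1 * r i j.
    rewrite (bigD1 i) //= eqxx big1 => [|i' /negPf ne]; first by rewrite mul1r; ring.
    by rewrite [i == i']eq_sym ne mul0r mulr0 mul0r.
  transitivity (l ^+ (K - (e i).1) * kappa ^+ (e i).2 *
      (l ^+ (e i).1 * (u j)%:Z ^+ (e i).1 * (1 + l * t' (e i).2) ^+ u j)
      + l ^+ N * l ^+ K * (u j)%:Z ^+ (e i).1 * r i j).
    have -> : l ^+ K = l ^+ (K - (e i).1) * l ^+ (e i).1 by rewrite -exprD subnK // ltnW.
    by ring.
  rewrite hd // big_distrr /=; congr (_ + _).
  by apply: eq_bigr => m _; ring.
rewrite det_sum_expand; apply: rpred_sum => phi /injectiveP inj_phi.
apply: dvdz_mulr; rewrite big_split /= -expr_sum; apply: dvdz_mulr.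
apply: dvdz_exp2l; apply: weight_sum_ge inj_phi _ => m ltmN.
exact: card_weight_sum.
Qed.

(** * Congruences and lifting of exponents *)

Lemma dvdz_subM (d a b a' b' : int) :
  (d %| a - b)%Z -> (d %| a' - b')%Z -> (d %| a * a' - b * b')%Z.
Proof.
move=> h h'; have -> : a * a' - b * b' = (a - b) * a' + b * (a' - b') by ring.
by apply: rpredD; [apply: dvdz_mulr | apply: dvdz_mull].
Qed.

Lemma dvdz_subX (d a b : int) (n : nat) : (d %| a - b)%Z -> (d %| a ^+ n - b ^+ n)%Z.
Proof. by move=> h; rewrite subrXX dvdz_mulr. Qed.

Lemma dvdz_sub_trans (d b a c : int) : (d %| a - b)%Z -> (d %| b - c)%Z -> (d %| a - c)%Z.
Proof. move=> h h'; have -> : a - c = (a - b) + (b - c) by ring. exact: rpredD. Qed.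

Lemma dvdz_subC (d a b : int) : (d %| a - b)%Z = (d %| b - a)%Z.
Proof. by rewrite -opprB rpredN. Qed.

Lemma dvdz_nat_sub (d a b : nat) : (d%:Z %| a%:Z - b%:Z)%Z = (a == b %[mod d])%N.
Proof. by rewrite -eqz_mod_dvd !modz_nat. Qed.

Lemma coprimez_prime (l : nat) (a : int) : prime l -> coprimez l a = ~~ (l %| a)%Z.
Proof. by move=> pl; rewrite coprimezE absz_nat prime_coprime // dvdzE. Qed.

Lemma prime_ndvdz_exp (l : nat) (a : int) (n : nat) :
  prime l -> ~~ (l %| a)%Z -> ~~ (l %| a ^+ n)%Z.
Proof. by move=> pl; rewrite -!coprimez_prime //; apply: coprimezXr. Qed.

Lemma dvdz_geom_sum (d a b : int) (n : nat) : (d %| a - b)%Z ->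
  (d %| \sum_(i < n) a ^+ (n.-1 - i) * b ^+ i - n%:Z * b ^+ n.-1)%Z.
Proof.
move=> h; have -> : n%:Z * b ^+ n.-1 = \sum_(i < n) b ^+ (n.-1 - i) * b ^+ i.
  transitivity (\sum_(i < n) b ^+ n.-1); first by rewrite sumr_const card_ord -mulr_natl natz.
  by apply: eq_bigr => i _; rewrite -exprD subnK //; have := ltn_ord i; lia.
rewrite -sumrB; apply: rpred_sum => i _; rewrite -mulrBl.
by apply: dvdz_mulr; apply: dvdz_subX.
Qed.

Lemma dvdz_prime_lift (l k : nat) (a b : int) : (0 < k)%N ->
  (l%:Z ^+ k %| a - b)%Z -> (l%:Z ^+ k.+1 %| a ^+ l - b ^+ l)%Z.
Proof.
move=> k0 h; rewrite subrXX exprSr dvdz_mul //.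
have hl : (l%:Z %| a - b)%Z by apply: dvdz_trans h; apply: dvdz_exp.
rewrite -[X in (_ %| X)%Z](subrK (l%:Z * b ^+ l.-1)).
by apply: rpredD; [apply: dvdz_geom_sum | apply: dvdz_mulr].
Qed.

Lemma dvdz_prime_lift_iter (l n : nat) (a b : int) :
  (l%:Z %| a - b)%Z -> (l%:Z ^+ n.+1 %| a ^+ (l ^ n) - b ^+ (l ^ n))%Z.
Proof.
move=> h; elim: n => [|n IH]; first by rewrite expr1 expn0 !expr1.
by rewrite expnSr !exprM; apply: dvdz_prime_lift.
Qed.

(* For [l = 2] a congruence mod 2 would not suffice in [lifting_exponent]:
   [3 ^ 2 - 1] is divisible by 8, but [2 * (3 - 1)] is not. *)
Definition padic_base (l : nat) : nat := if l == 2%N then 4 else l.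

Lemma dvdz_padic_base (l : nat) (a : int) : (padic_base l %| a)%Z -> (l %| a)%Z.
Proof.
by rewrite /padic_base; case: eqP => [->|//]; apply: dvdz_trans.
Qed.

(** One lifting step: when [l] does not divide [b], the last factor is prime to [l], so taking
    [l]-th powers gains exactly one factor [l]. *)
Lemma prime_power_quotient (l : nat) (b c : int) : prime l -> (padic_base l %| c)%Z ->
  exists z, (b + c) ^+ l - b ^+ l = c * l%:Z * (b ^+ l.-1 + l%:Z * z).
Proof.
move=> pl; rewrite /padic_base; case: eqP => [->|/eqP l2] /dvdzP [w ->].
  by exists w; rewrite !expr2 expr1; ring.
have l3 : (2 < l)%N by rewrite ltn_neqAle eq_sym l2 prime_gt1.
suff /dvdzP [z hz] : (w * l%:Z * l%:Z ^+ 2 %| (b + w * l%:Z) ^+ l - b ^+ l - w * l%:Z * l%:Z * b ^+ l.-1)%Z.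
  exists z; move/eqP: hz; rewrite subr_eq => /eqP ->; rewrite expr2; ring.
have -> : (b + w * l%:Z) ^+ l - b ^+ l - w * l%:Z * l%:Z * b ^+ l.-1 =
    \sum_(i < l.-1) b ^+ (l.-2 - i) * (w * l%:Z) ^+ i.+2 *+ 'C(l, i.+2).
  rewrite exprDn; case: (l) l3 => [//|[//|l' _]].
  rewrite big_ord_recl big_ord_recl /= subn0 expr0 mulr1 bin0 mulr1n subn1 /= expr1 bin1.
  rewrite -[_ *+ l'.+2]mulr_natr natz [X in _ = X](eq_bigr (fun i : 'I_l'.+1 => b ^+ (l'.+2 - i.+2) * (w * l'.+2%:Z) ^+ i.+2 *+ 'C(l'.+2, i.+2))) //.
  by rewrite /bump /=; ring.
(* The last binomial term has enough factors [l] because [l] is at least 3; in the others [l]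
   divides the binomial coefficient. *)
apply: rpred_sum => i _; have := ltn_ord i.
rewrite leq_eqVlt => /orP [/eqP|lt_il].
  move=> il; rewrite (_ : i.+2 = l) ?binn ?mulr1n; last by lia.
  apply: dvdz_mull; rewrite -{2}(subnKC l3) exprD.
  have -> : (w * l%:Z) ^+ 3 * (w * l%:Z) ^+ (l - 3) =
      w * l%:Z * l%:Z ^+ 2 * (w ^+ 2 * (w * l%:Z) ^+ (l - 3)) by rewrite !exprS !expr0; ring.
  exact: dvdz_mulr.
have /dvdnP [k ->] : (l %| 'C(l, i.+2))%N by apply: prime_dvd_bin => //; lia.
have -> : b ^+ (l.-2 - i) * (w * l%:Z) ^+ i.+2 *+ (k * l) =
    w * l%:Z * l%:Z ^+ 2 * (w * b ^+ (l.-2 - i) * (w * l%:Z) ^+ i * k%:Z).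
  by rewrite -mulr_natr natz PoszM !exprS !expr0; ring.
exact: dvdz_mulr.
Qed.

(** Induction on [d]: a factor [l] of [d] is split off by [prime_power_quotient]. When [l] does not
    divide [d], the quotient of [a ^+ d - b ^+ d] by [a - b] is congruent to [d * b ^+ d.-1] modulo
    [l], hence prime to [l]. *)
Lemma lifting_exponent (l : nat) (a b : int) (d m : nat) :
  prime l -> ~~ (l %| b)%Z -> (padic_base l %| a - b)%Z ->
  (l%:Z ^+ m %| a ^+ d - b ^+ d)%Z -> (l%:Z ^+ m %| d%:Z * (a - b))%Z.
Proof.
move=> pl; elim/ltn_ind: d m a b => d IH m a b lb hab.
have [/dvdnP [d' ed]|ld] := boolP (l %| d)%N.
  have [->|d0] := posnP d; first by rewrite mul0r dvdz0.
  have lt_d' : (d' < d)%N by rewrite ed ltn_Pmulr ?prime_gt1 //; move: d0; rewrite ed muln_gt0 => /andP [].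
  rewrite ed !exprM.
  have hab' : (padic_base l %| a ^+ d' - b ^+ d')%Z by apply: dvdz_subX.
  have [z] := prime_power_quotient (b ^+ d') pl hab'.
  rewrite [b ^+ d' + _]addrC subrK => ->; set U := b ^+ d' ^+ _ + _.
  have copU : coprimez (l%:Z ^+ m) U.
    apply: coprimezXl; rewrite coprimez_prime // /U -exprM.
    apply: contra (prime_ndvdz_exp (d' * l.-1) pl lb) => h.
    by rewrite -[X in (_ %| X)%Z](addrK (l%:Z * z)); apply: rpredB => //; apply: dvdz_mulr.
  rewrite (Gauss_dvdzl _ copU); case: m {copU} => [|m]; first by rewrite expr0 dvd1z.
  rewrite exprSr dvdz_mul2r ?lt0r_neq0 ?ltz_nat ?prime_gt0 // => h.
  have -> : (d' * l)%N%:Z * (a - b) = d'%:Z * (a - b) * l%:Z by rewrite PoszM; ring.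
  by apply: dvdz_mul => //; apply: IH.
set S := \sum_(i < d) a ^+ (d.-1 - i) * b ^+ i.
suff copS : coprimez (l%:Z ^+ m) S by rewrite subrXX (Gauss_dvdzl _ copS) => h; apply: dvdz_mull.
apply: coprimezXl; rewrite coprimez_prime //.
have := dvdz_geom_sum d (dvdz_padic_base hab); rewrite -/S => hS.
apply: contra ld => hlS.
have : (l%:Z %| d%:Z * b ^+ d.-1)%Z.
  by rewrite -[X in (_ %| X)%Z](subKr S); apply: rpredB.
by rewrite Gauss_dvdzl // coprimez_prime // prime_ndvdz_exp.
Qed.

(** * Units modulo prime powers and the parametrization of [a1 ^ r * a2 ^ s] *)

Lemma Posz_exp (m n : nat) : (m ^ n)%N%:Z = m%:Z ^+ n.
Proof. by elim: n => // n IH; rewrite expnS exprS PoszM IH. Qed.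

Lemma int_euler (n : nat) (a : int) : (0 < n)%N -> coprimez n a ->
  (n %| a ^+ totient n - 1)%Z.
Proof.
move=> n0 co_na.
have ha : (n %| a - (`|(a %% n)%Z|%N)%:Z)%Z.
  by rewrite gez0_abs ?modz_ge0 ?lt0r_neq0 ?ltz_nat // -eqz_mod_dvd modz_mod.
apply: dvdz_sub_trans (dvdz_subX _ ha) _.
rewrite -Posz_exp dvdz_nat_sub.
apply/eqP/Euler_exp_totient.
have : coprimez n (a %% n)%Z by rewrite /coprimez gcdz_modr.
by rewrite coprimezE absz_nat coprime_sym.
Qed.

(* [a ^ F] and [a ^ E] are approximations of the Teichmueller representative of
   [a] and of its principal unit part. *)
Lemma teichmuller_exponents (l M : nat) : prime l ->
  exists E F : nat,
  (forall a : int, ~~ (l %| a)%Z -> (l = 2%N -> (4 %| a - 1)%Z) ->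
     (padic_base l %| a ^+ E - 1)%Z /\ (l%:Z ^+ M %| a ^+ (E + F) - a)%Z) /\
  (forall a b : int, (padic_base l %| a - b)%Z -> (l%:Z ^+ M %| a ^+ F - b ^+ F)%Z).
Proof.
move=> pl; rewrite /padic_base; case: eqP => [l2|/eqP l2].
  (* For [l = 2] the number [a] is already a principal unit, and its Teichmueller part is
     trivial. *)
  exists 1%N, 0%N; split=> [a la /(_ l2) a4|a b _]; rewrite ?expr0 ?subrr ?dvdz0 //.
have l3 : (2 < l)%N by rewrite ltn_neqAle eq_sym l2 prime_gt1.
have co : coprime l.-1 (l ^ M) by rewrite coprimeXr // coprime_sym coprimenP // prime_gt0.
(* [E] is 0 and [F] is 1 modulo [l.-1], while [E] is 1 and [F] is 0 modulo [l ^ M]; so [E + F] is 1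
   modulo the order of the unit group modulo [l ^ M.+1]. *)
set E := chinese l.-1 (l ^ M) 0 1; set F := chinese l.-1 (l ^ M) 1 0.
have El : (l.-1 %| E)%N by rewrite /dvdn chinese_modl // mod0n.
have Fl : (l ^ M %| F)%N by rewrite /dvdn chinese_modr // mod0n.
have EF : (E + F = 1 %[mod totient (l ^ M.+1)])%N.
  rewrite totient_pfactor //=; apply/eqP; rewrite chinese_remainder // -!(modnDm E F).
  by rewrite !chinese_modl // !chinese_modr // !modnDm !eqxx.
exists E, F; split=> [a la _|a b hab].
  split.
    case/dvdnP: El => k ->; rewrite mulnC exprM -[X in (_ - X)](expr1n _ k).
    apply: dvdz_subX; have := @int_euler l a (prime_gt0 pl).
    by rewrite coprimez_prime // totient_prime // => ->.
  have hM : (l%:Z ^+ M %| l%:Z ^+ M.+1)%Z by apply: dvdz_exp2l.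
  apply: dvdz_trans hM _.
  have phi2 : (1 < totient (l ^ M.+1))%N.
    rewrite totient_pfactor //= (leq_trans (_ : 1 < l.-1)%N) //; first by lia.
    by rewrite leq_pmulr // expn_gt0 prime_gt0.
  rewrite (divn_eq (E + F) (totient (l ^ M.+1))) EF modn_small // exprD expr1 mulnC exprM.
  rewrite -[X in (_ - X)]mul1r -mulrBl; apply: dvdz_mulr.
  rewrite -[X in (_ - X)](expr1n _ ((E + F) %/ totient (l ^ M.+1))).
  apply: dvdz_subX; have := @int_euler (l ^ M.+1) a.
  rewrite expn_gt0 prime_gt0 // Posz_exp; apply => //.
  by apply: coprimezXl; rewrite coprimez_prime.
case/dvdnP: Fl => k ->; rewrite mulnC !exprM; apply: dvdz_subX.
apply: dvdz_trans (dvdz_prime_lift_iter M hab).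
exact: dvdz_exp2l.
Qed.

(** The [l ^ M]-th power of a principal unit is 1 modulo [l ^ M.+1], so its exponents matter only
    modulo [l ^ M]. *)
Lemma dvdz_principal_unit_exp (l M n : nat) (a : int) :
  (l%:Z %| a - 1)%Z -> (n = 1 %[mod l ^ M])%N -> (l%:Z ^+ M %| a ^+ n - a)%Z.
Proof.
move=> ha; case: n => [|n] /eqP.
  rewrite eq_sym eqn_mod_dvd // subn0 dvdn1 -(eqr_nat int) natrX => /eqP e.
  by rewrite -[l%:Z]natz e dvd1z.
rewrite eqn_mod_dvd // subn1 /= => /dvdnP [k ->].
rewrite exprS -[X in (_ - X)]mulr1 -mulrBr; apply: dvdz_mull.
rewrite mulnC exprM -[X in (_ - X)](expr1n _ k); apply: dvdz_subX.
apply: (@dvdz_trans (l%:Z ^+ M.+1)); first exact: dvdz_exp2l.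
by have := dvdz_prime_lift_iter M ha; rewrite expr1n.
Qed.

(** If b is an inverse of [c2] modulo [l ^ M], then [a1] to the power b is such a root: its [c2]-th
    power returns [a1], and its [c1]-th power is [a2] by the assumed congruence. *)
Lemma common_root_of_units (l M c1 c2 : nat) (a1 a2 : int) : prime l ->
  (l%:Z %| a1 - 1)%Z -> (l%:Z %| a2 - 1)%Z -> ~~ (l %| c2)%N ->
  (l%:Z ^+ M %| a1 ^+ c1 - a2 ^+ c2)%Z ->
  exists t, (l%:Z ^+ M %| a1 - (1 + l%:Z * t) ^+ c2)%Z /\
            (l%:Z ^+ M %| a2 - (1 + l%:Z * t) ^+ c1)%Z.
Proof.
move=> pl h1 h2 lc2 h12.
have co : coprime c2 (l ^ M) by rewrite coprimeXr // coprime_sym prime_coprime.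
have /dvdnP [b hb] : (c2 %| chinese c2 (l ^ M) 0 1)%N by rewrite /dvdn chinese_modl // mod0n.
have hb1 : (b * c2 = 1 %[mod l ^ M])%N by rewrite -hb chinese_modr.
have /dvdzP [t ht] : (l%:Z %| a1 ^+ b - 1)%Z by rewrite -(expr1n _ b); apply: dvdz_subX.
exists t; have -> : 1 + l%:Z * t = a1 ^+ b by rewrite [l%:Z * t]mulrC -ht addrC subrK.
rewrite -!exprM; split; rewrite dvdz_subC.
  exact: dvdz_principal_unit_exp.
rewrite mulnC exprM; apply: dvdz_sub_trans (dvdz_subX b h12) _.
by rewrite -exprM mulnC; apply: dvdz_principal_unit_exp.
Qed.

(** Here [1 + l * t] is a common root of the principal parts of [a1] and [a2], and [kappa] is the
    Teichmueller part, constant on a residue class. Removing the gcd from [b1] and [b2] costs its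
    [l]-adic valuation. *)
Lemma padic_parametrization (l M a1 a2 b1 b2 : nat) :
  prime l -> ~~ (l %| a1)%N -> ~~ (l %| a2)%N ->
  (l = 2%N -> (4 %| a1%:Z - 1)%Z /\ (4 %| a2%:Z - 1)%Z) -> (0 < b1)%N -> (0 < b2)%N ->
  (l%:Z ^+ M %| a1%:Z ^+ b1 - a2%:Z ^+ b2)%Z ->
  exists t, forall r0 s0, exists kappa, forall r s,
    (padic_base l %| a1%:Z ^+ r * a2%:Z ^+ s - a1%:Z ^+ r0 * a2%:Z ^+ s0)%Z ->
    (l%:Z ^+ (M - logn l (gcdn b1 b2)) %| a1%:Z ^+ r * a2%:Z ^+ s -
      kappa * (1 + l%:Z * t) ^+ (r * (b2 %/ gcdn b1 b2) + s * (b1 %/ gcdn b1 b2)))%Z.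
Proof.
move=> pl la1 la2 l2 b10 b20 h12.
set d := gcdn b1 b2; set c1 := (b1 %/ d)%N; set c2 := (b2 %/ d)%N.
set M' := (M - _)%N.
have d0 : (0 < d)%N by rewrite gcdn_gt0 b10.
have eb1 : b1 = (c1 * d)%N by rewrite divnK ?dvdn_gcdl.
have eb2 : b2 = (c2 * d)%N by rewrite divnK ?dvdn_gcdr.
have co_c : coprime c1 c2.
  by rewrite /coprime -(eqn_pmul2r d0) muln_gcdl -eb1 -eb2 mul1n.
have [E [F [hE hF]]] := teichmuller_exponents M' pl.
have la1' : ~~ (l %| a1%:Z)%Z by [].
have la2' : ~~ (l %| a2%:Z)%Z by [].
have [u1 v1] := hE a1 la1' (fun e => (l2 e).1).
have [u2 v2] := hE a2 la2' (fun e => (l2 e).2).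
have hA : (l%:Z ^+ M' %| (a1%:Z ^+ E) ^+ c1 - (a2%:Z ^+ E) ^+ c2)%Z.
  have lA2 : ~~ (l %| (a2%:Z ^+ E) ^+ c2)%Z by rewrite !prime_ndvdz_exp.
  have hb : (padic_base l %| (a1%:Z ^+ E) ^+ c1 - (a2%:Z ^+ E) ^+ c2)%Z.
    apply: (@dvdz_sub_trans _ 1); first by rewrite -(expr1n _ c1); apply: dvdz_subX.
    by rewrite dvdz_subC -(expr1n _ c2); apply: dvdz_subX.
  have := @lifting_exponent l _ _ d M pl lA2 hb.
  have -> : ((a1%:Z ^+ E) ^+ c1) ^+ d = (a1%:Z ^+ b1) ^+ E by rewrite -!exprM -eb1 mulnC.
  have -> : ((a2%:Z ^+ E) ^+ c2) ^+ d = (a2%:Z ^+ b2) ^+ E by rewrite -!exprM -eb2 mulnC.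
  move=> /(_ (dvdz_subX E h12)); set D := _ - _.
  have [le_M|/ltnW lt_M] := leqP M (logn l d).
    by rewrite /M' (eqP (_ : M - logn l d == 0)%N) ?subn_eq0 // expr0 dvd1z.
  have [d' [ld' ed']] : exists d', ~~ (l %| d')%N /\ d = (d' * l ^ logn l d)%N.
    by have [d' co ed] := pfactor_coprime pl d0; exists d'; rewrite -prime_coprime.
  rewrite -(subnK lt_M) -/M' exprD {1}ed' PoszM Posz_exp -mulrA [_%:Z ^+ _ * D]mulrC mulrA.
  rewrite dvdz_mul2r ?expf_neq0 ?lt0r_neq0 ?ltz_nat ?prime_gt0 //.
  by rewrite Gauss_dvdzr // ; apply: coprimezXl; rewrite coprimez_prime.
(* Since [c1] and [c2] are coprime, [l] does not divide both, and one of them can be inverted. *)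
have [t [ht1 ht2]] : exists t, (l%:Z ^+ M' %| a1%:Z ^+ E - (1 + l%:Z * t) ^+ c2)%Z /\
      (l%:Z ^+ M' %| a2%:Z ^+ E - (1 + l%:Z * t) ^+ c1)%Z.
  have [lc2|lc2] := boolP (l %| c2)%N; last first.
    by apply: common_root_of_units => //; apply: dvdz_padic_base.
  have lc1 : ~~ (l %| c1)%N.
    apply/negP => lc1; have : (l %| gcdn c1 c2)%N by rewrite dvdn_gcd lc1.
    by rewrite (eqP co_c) dvdn1 => /eqP l1; move: pl; rewrite l1.
  have [||||t [q1 q2]] := @common_root_of_units l M' c2 c1 (a2%:Z ^+ E) (a1%:Z ^+ E) pl => //.
  - exact: dvdz_padic_base.
  - exact: dvdz_padic_base.
  - by rewrite dvdz_subC.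
  by exists t.
exists t => r0 s0; exists ((a1%:Z ^+ r0 * a2%:Z ^+ s0) ^+ F) => r s /hF hrs.
have split_a : (l%:Z ^+ M' %| a1%:Z ^+ r * a2%:Z ^+ s -
    (a1%:Z ^+ r * a2%:Z ^+ s) ^+ F * ((a1%:Z ^+ E) ^+ r * (a2%:Z ^+ E) ^+ s))%Z.
  rewrite dvdz_subC.
  have -> : (a1%:Z ^+ r * a2%:Z ^+ s) ^+ F * ((a1%:Z ^+ E) ^+ r * (a2%:Z ^+ E) ^+ s) =
      (a1%:Z ^+ (E + F)) ^+ r * (a2%:Z ^+ (E + F)) ^+ s.
    rewrite exprMn -!exprM !mulnDl !exprD !exprM ![in RHS]mulrA.
    by rewrite -!exprM ![(F * _)%N]mulnC; ring.
  by apply: dvdz_subM; apply: dvdz_subX.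
apply: dvdz_sub_trans split_a _; apply: dvdz_subM => //.
rewrite exprD ![(_ * c2)%N]mulnC ![(_ * c1)%N]mulnC !exprM.
by apply: dvdz_subM; apply: dvdz_subX.
Qed.

(** * Choice of the points and of the parameters *)

Lemma norm_det_le (A : numDomainType) (N : nat) (M : 'M[A]_N) (b : 'I_N -> A) :
  (forall i j, `|M i j| <= b i) -> `|\det M| <= N`!%:R * \prod_i b i.
Proof.
move=> hM; apply: le_trans (ler_norm_sum _ _ _) _.
apply: (@le_trans _ _ (\sum_(s : 'S_N) \prod_i b i)); last first.
  by rewrite sumr_const card_Sn mulr_natl.
apply: ler_sum => s _; rewrite normrM normrX normrN1 expr1n mul1r normr_prod.
by apply: ler_prod => i _; rewrite normr_ge0 hM.
Qed.

Lemma pigeonhole_class (T : finType) (g N : nat) (cl : T -> 'I_g) :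
  (0 < g)%N -> (0 < N)%N -> (g * N <= #|T|)%N ->
  exists (c : 'I_g) (p : 'I_N -> T), injective p /\ forall i, cl (p i) = c.
Proof.
move=> g0 N0 hT.
have [/existsP [c hc]|/existsPn hno] := boolP [exists c, N <= #|[set x | cl x == c]|]%N.
  exists c, (fun i => enum_val (widen_ord hc i)); split.
    by move=> i j /enum_val_inj /(congr1 val) /= /val_inj.
  by move=> i; have := enum_valP (widen_ord hc i); rewrite inE => /eqP.
have : (#|T| <= g * N.-1)%N.
  rewrite -sum1_card (partition_big cl predT) //=.
  rewrite -[X in (_ <= X * _)%N]card_ord -sum_nat_const; apply: leq_sum => c _.
  rewrite sum1_card; have := hno c; rewrite -ltnNge => lt_cN.
  rewrite -ltnS (prednK N0); apply: leq_ltn_trans lt_cN.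
  by apply: subset_leq_card; apply/fintype.subsetP => x; rewrite !inE.
move=> h; have := leq_trans hT h.
by rewrite leq_pmul2l // leqNgt prednK ?leqnn.
Qed.

Lemma coprime_expM_inj (a1 a2 r s r' s' : nat) : (1 < a1)%N -> (1 < a2)%N -> coprime a1 a2 ->
  (a1 ^ r * a2 ^ s = a1 ^ r' * a2 ^ s')%N -> r = r' /\ s = s'.
Proof.
move=> h1 h2 co.
wlog le_rr' : r s r' s' / (r <= r')%N.
  move=> H e; have [h|/ltnW h] := leqP r r'; first exact: H.
  by have [-> ->] := H r' s' r s h (esym e).
have [k ->] : exists k, r' = (r + k)%N by exists (r' - r)%N; rewrite subnKC.
have a10 : (0 < a1 ^ r)%N by rewrite expn_gt0 (ltnW h1).
rewrite expnD -mulnA => /eqP; rewrite (eqn_pmul2l a10) => /eqP e.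
have : (a1 ^ k %| a2 ^ s)%N by rewrite e dvdn_mulr.
have co' : coprime (a1 ^ k) (a2 ^ s) by rewrite coprimeXl // coprimeXr.
rewrite -[(_ ^ s)%N]muln1 Gauss_dvdr // dvdn1 -(expn0 a1) eqn_exp2l // => /eqP e0.
move: e; rewrite e0 expn0 mul1n addn0 => /eqP; rewrite eqn_exp2l // => /eqP.
by split.
Qed.

(** The pair [(i, i')] is a multiple of [(b1, b2)] divided by the gcd, so the gcd-th powers of
    [a1 ^ i] and [a2 ^ i'] are congruent modulo [l ^ M]. Lifting of exponents then makes [l ^ M]
    divide the gcd times [a1 ^ i - a2 ^ i'], which is nonzero because the bases are coprime. *)
Lemma coincidence_bound (l M a1 a2 b1 b2 i i' : nat) :
  prime l -> ~~ (l %| a2)%N -> (1 < a1)%N -> (1 < a2)%N -> coprime a1 a2 ->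
  (0 < b1)%N -> (0 < b2)%N -> (0 < i)%N ->
  (i * b2 = i' * b1)%N -> (padic_base l %| a1%:Z ^+ i - a2%:Z ^+ i')%Z ->
  (l%:Z ^+ M %| a1%:Z ^+ b1 - a2%:Z ^+ b2)%Z ->
  (l ^ M <= gcdn b1 b2 * maxn (a1 ^ i) (a2 ^ i'))%N.
Proof.
move=> pl la2 h1 h2 co b10 b20 i0 e hbase hM.
set d := gcdn b1 b2; have d0 : (0 < d)%N by rewrite gcdn_gt0 b10.
have /dvdnP [c1 eb1] : (d %| b1)%N by apply: dvdn_gcdl.
have /dvdnP [c2 eb2] : (d %| b2)%N by apply: dvdn_gcdr.
have co_c : coprime c1 c2 by rewrite /coprime -(eqn_pmul2r d0) muln_gcdl -eb1 -eb2 mul1n.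
have e' : (i * c2 = i' * c1)%N.
  by apply/eqP; rewrite -(eqn_pmul2r d0) -!mulnA -eb1 -eb2 e.
have /dvdnP [j ei] : (c1 %| i)%N by rewrite -(Gauss_dvdl _ co_c) e' dvdn_mull.
have c10 : (0 < c1)%N by move: b10; rewrite eb1 muln_gt0 => /andP [].
have ei' : i' = (j * c2)%N.
  by apply/eqP; rewrite -(eqn_pmul2r c10) -e' ei -!mulnA [(c2 * _)%N]mulnC.
have hd : (l%:Z ^+ M %| (a1%:Z ^+ i) ^+ d - (a2%:Z ^+ i') ^+ d)%Z.
  rewrite -!exprM ei ei' -!mulnA -eb1 -eb2 ![(j * _)%N]mulnC !exprM.
  exact: dvdz_subX.
have := lifting_exponent pl (prime_ndvdz_exp i' pl (la2 : ~~ (l %| a2%:Z)%Z)) hbase hd.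
have neq : a1%:Z ^+ i != a2%:Z ^+ i'.
  apply/eqP; rewrite -!Posz_exp => -[] E.
  have [] := @coprime_expM_inj a1 a2 i 0 0 i' h1 h2 co; first by rewrite expn0 muln1 mul1n.
  by move=> i00; rewrite i00 in i0.
rewrite dvdzE abszM abszX !absz_nat => /dvdn_leq; rewrite muln_gt0 d0 absz_gt0 subr_eq0 neq.
move=> /(_ isT) /leq_trans; apply; rewrite leq_mul2l; apply/orP; right.
rewrite -!Posz_exp; move: (a1 ^ i)%N (a2 ^ i')%N => A C; clear; lia.
Qed.

(* The interpolation functions are [X ^ k * Y ^ l] with [k < degX] and [l < degY];
   [g] bounds the number of residue classes of [a1 ^ r * a2 ^ s], the bases satisfy
   [a_i <= 2 ^ h], and all the integers [r * b2 + s * b1] are at most [2 ^ chi]. *)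
Definition degY (chi : nat) : nat := 4 * chi.+1.
Definition box_side (g h chi : nat) : nat := 64 * g * h * degY chi.
Definition degX (g h chi : nat) : nat := 4096 * g * h ^ 2 * degY chi.
Definition det_dim (g h chi : nat) : nat := degX g h chi * degY chi.

Lemma degX_gt0 (g h chi : nat) : (0 < g)%N -> (0 < h)%N -> (0 < degX g h chi)%N.
Proof. by move=> g0 h0; rewrite /degX !muln_gt0 g0 h0. Qed.

Lemma box_side_gt0 (g h chi : nat) : (0 < g)%N -> (0 < h)%N -> (0 < box_side g h chi)%N.
Proof. by move=> g0 h0; rewrite /box_side !muln_gt0 g0 h0. Qed.

(** With this, the pigeonhole principle finds [det_dim] points of a square box in one of [g] residue
    classes. *)
Lemma box_side_sqr (g h chi : nat) : (box_side g h chi ^ 2 = g * det_dim g h chi)%N.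
Proof. by rewrite /det_dim /degX /box_side; ring. Qed.

Lemma box_side_lt_dim (g h chi : nat) : (0 < g)%N -> (0 < h)%N ->
  (h * box_side g h chi < det_dim g h chi)%N.
Proof.
move=> g0 h0; rewrite /det_dim /degX /box_side.
rewrite [X in (X < _)%N](_ : _ = 64 * (g * h ^ 2 * degY chi))%N; last by ring.
rewrite [X in (_ < X)%N](_ : _ = (4096 * degY chi) * (g * h ^ 2 * degY chi))%N; last by ring.
by rewrite ltn_pmul2r ?muln_gt0 ?expn_gt0 ?g0 ?h0 // /degY; lia.
Qed.

(* [degX], [degY] and [box_side] are chosen so that this holds: it is the
   inequality contradicting both the p-adic and the archimedean estimate of the
   interpolation determinant. *)
Lemma dim_large (g h chi : nat) : (0 < g)%N -> (0 < h)%N ->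
  (2 * (chi + degX g h chi * chi.+1 + degY chi * (8 * h * box_side g h chi + 2) + 2)
    < (det_dim g h chi).-1)%N.
Proof.
move=> g0 h0; rewrite /det_dim /degX /box_side.
set A := (g * h ^ 2)%N; have A0 : (0 < A)%N by rewrite muln_gt0 g0 expn_gt0 h0.
set L := degY chi; have eL : L = (4 * chi.+1)%N by [].
rewrite [(4096 * g * h ^ 2 * L * L)%N](_ : _ = 4096 * (A * L ^ 2))%N; last by rewrite /A; ring.
rewrite [(4096 * g * h ^ 2 * L * chi.+1)%N](_ : _ = 1024 * (A * L ^ 2))%N; last first.
  have -> : (A * L ^ 2 = A * L * (4 * chi.+1))%N by rewrite -eL; ring.
  by rewrite /A; ring.
rewrite [(L * _)%N](_ : _ = 512 * (A * L ^ 2) + 2 * L)%N; last by rewrite /A; ring.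
have : (L <= A * L ^ 2)%N by rewrite -[(L ^ 2)%N]/(L * L)%N mulnA leq_pmull // muln_gt0 A0 eL.
by move: eL; set X := (A * L ^ 2)%N; clearbody L X; lia.
Qed.

(** The zero estimate is applied to sums of one of the first [L] points and any of the [K * L]
    points; the ordinates [a1 ^ r * a2 ^ s] are distinct because the bases are coprime. *)
Lemma grid_determinant (K L a1 a2 c1 c2 : nat) (p : 'I_(K * L) -> nat * nat) :
  (0 < K)%N -> (0 < L)%N -> (1 < a1)%N -> (1 < a2)%N -> coprime a1 a2 ->
  injective p -> injective (fun i => (p i).1 * c2 + (p i).2 * c1)%N ->
  exists (e : 'I_(K * L) -> 'I_K * 'I_L) (f : 'I_(K * L) -> 'I_(K * L) * 'I_(K * L)),
  let r j := ((p (f j).1).1 + (p (f j).2).1)%N in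
  let s j := ((p (f j).1).2 + (p (f j).2).2)%N in
  \det (\matrix_(i, j)
     ((r j * c2 + s j * c1)%N%:Z ^+ (e i).1 * (a1 ^ r j * a2 ^ s j)%N%:Z ^+ (e i).2)) != 0.
Proof.
move=> K0 L0 h1 h2 co inj_p inj_x.
have le_L : (L <= K * L)%N by rewrite leq_pmull.
pose x i := ((p i).1 * c2 + (p i).2 * c1)%N.
pose y i := (a1 ^ (p i).1 * a2 ^ (p i).2)%N.
have inj_y : injective y.
  move=> i j /(coprime_expM_inj h1 h2 co) [e1 e2]; apply: inj_p.
  by rewrite [p i]surjective_pairing e1 e2 -surjective_pairing.
have inj_yw : injective (fun i => y (widen_ord le_L i)).
  by move=> i j /inj_y /(congr1 val) /= /val_inj.
have y0 i : (0 < y i)%N by rewrite muln_gt0 !expn_gt0 (ltnW h1) (ltnW h2).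
have [|e [f hf]] := interpolation_points (fun i => x (widen_ord le_L i)) K0 inj_yw inj_x y0.
  by rewrite ltn_pmul2r // ltn_predL.
exists e, (fun j => (widen_ord le_L (f j).1, (f j).2)) => r s.
apply: contraNneq hf => hdet; apply/eqP; rewrite -[RHS]hdet; congr (\det _).
apply/matrixP => i j; rewrite !mxE /r /s /x /y /=; congr (_ * _); congr (Posz _ ^+ _).
  by ring.
by rewrite !expnD; ring.
Qed.

(** * The lower bound for two logarithms at a prime *)

Lemma exp_le_pow2 (a h r n : nat) : (a <= 2 ^ h)%N -> (r <= n)%N -> (a ^ r <= 2 ^ (h * n))%N.
Proof.
move=> ha hr; apply: (@leq_trans ((2 ^ h) ^ r)%N).
  by case: r {hr} => // r; rewrite leq_exp2r.
by rewrite -expnM leq_exp2l // leq_mul2l hr orbT.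
Qed.

Lemma fact_le_exp (n : nat) : (n`! <= n ^ n)%N.
Proof.
rewrite -ffactnn ffact_prod -[X in (_ <= _ ^ X)%N]card_ord -prod_nat_const.
by apply: leq_prod => i _; apply: leq_subr.
Qed.

(** For larger [M], a nonzero integer determinant of order N would be divisible by
    [l ^ ('C(N, 2) - N * K)] and too small for that, by [dim_large]. *)
Theorem padic_two_logs (l M a1 a2 b1 b2 h chi : nat) :
  prime l -> ~~ (l %| a1)%N -> ~~ (l %| a2)%N ->
  (l = 2%N -> (4 %| a1%:Z - 1)%Z /\ (4 %| a2%:Z - 1)%Z) ->
  coprime a1 a2 -> (1 < a1)%N -> (1 < a2)%N -> (a1 <= 2 ^ h)%N -> (a2 <= 2 ^ h)%N ->
  (0 < b1)%N -> (0 < b2)%N ->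
  (det_dim (padic_base l) h chi <= 2 ^ chi)%N ->
  (2 * box_side (padic_base l) h chi * (b1 + b2) <= 2 ^ chi)%N ->
  (l%:Z ^+ M %| a1%:Z ^+ b1 - a2%:Z ^+ b2)%Z ->
  (M < det_dim (padic_base l) h chi + chi)%N.
Proof.
move=> pl la1 la2 l2 co h1 h2 ha1 ha2 b10 b20.
set g := padic_base l; set n := box_side g h chi; set N := det_dim g h chi => hN hX hM.
rewrite ltnNge; apply/negP => hMN.
have l1 := prime_gt1 pl.
have g0 : (0 < g)%N by rewrite /g /padic_base; case: eqP => // _; apply: ltnW.
have hh : (0 < h)%N by case: (h) ha1 => //; rewrite expn0 leqNgt h1.
pose K := degX g h chi; pose L := degY chi.
have NE : N = (K * L)%N by [].
have L0 : (0 < L)%N by [].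
have K0 : (0 < K)%N by apply: degX_gt0.
have N0 : (0 < N)%N by rewrite NE muln_gt0 K0 L0.
have n0 : (0 < n)%N by apply: box_side_gt0.
have lt_nN : (h * n < N)%N := box_side_lt_dim chi g0 hh.
set d := gcdn b1 b2.
have d0 : (0 < d)%N by rewrite gcdn_gt0 b10.
have le_b12 : (b1 + b2 <= 2 ^ chi)%N.
  by apply: leq_trans hX; rewrite leq_pmull // muln_gt0 n0.
have hd : (d <= 2 ^ chi)%N.
  by apply: leq_trans le_b12; rewrite (leq_trans (dvdn_leq b10 (dvdn_gcdl _ _))) ?leq_addr.
have [t ht] := padic_parametrization pl la1 la2 l2 b10 b20 hM.
set c1 := (b1 %/ d)%N in ht; set c2 := (b2 %/ d)%N in ht.
set M' := (M - _)%N in ht.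
(* The surplus [chi] pays for the valuation of [d], which is at most [2 ^ chi]. *)
have le_NM' : (N <= M')%N.
  have : (2 ^ logn l d <= 2 ^ chi)%N.
    apply: leq_trans hd; apply: leq_trans (dvdn_leq d0 (pfactor_dvdnn l d)).
    by case: (logn l d) => // k; rewrite leq_exp2r.
  by rewrite leq_exp2l // => le_v; have := leq_sub hMN le_v; rewrite addnK.
pose cl (q : 'I_n * 'I_n) : 'I_g := Ordinal (ltn_pmod (a1 ^ q.1 * a2 ^ q.2) g0).
have [|c [p [inj_p hp]]] := @pigeonhole_class _ g N cl g0 N0.
  by rewrite card_prod !card_ord -box_side_sqr.
have hcl i j : (g %| a1%:Z ^+ (p i).1 * a2%:Z ^+ (p i).2 -
    a1%:Z ^+ (p j).1 * a2%:Z ^+ (p j).2)%Z.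
  rewrite -!Posz_exp -!PoszM dvdz_nat_sub; apply/eqP.
  by have := hp i; rewrite -(hp j) => /(congr1 val).
have co_g : forall a b, coprimez g (a1%:Z ^+ a * a2%:Z ^+ b).
  move=> a b; have co_l : coprimez l (a1%:Z ^+ a * a2%:Z ^+ b).
    by rewrite coprimezMr; apply/andP; split; apply: coprimezXr; rewrite coprimez_prime.
  rewrite /g /padic_base; case: eqP => // el.
  by rewrite (_ : (4 : nat)%:Z = l%:Z ^+ 2) ?el //; apply: coprimezXl; rewrite el in co_l.
have c10 : (0 < c1)%N by rewrite divn_gt0 // dvdn_leq // dvdn_gcdl.
have c20 : (0 < c2)%N by rewrite divn_gt0 // dvdn_leq // dvdn_gcdr.
have ed1 : b1 = (c1 * d)%N by rewrite divnK // dvdn_gcdl.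
have ed2 : b2 = (c2 * d)%N by rewrite divnK // dvdn_gcdr.
(* Two points of one residue class with the same abscissa would give a
   congruence between small powers of [a1] and [a2], to which the lifting of
   exponents applies directly. *)
have inj_x : injective (fun i => (p i).1 * c2 + (p i).2 * c1)%N.
  move=> i j; wlog le_ji : i j / ((p j).1 <= (p i).1)%N => [H|] /= eij.
    by have [le_ji|/ltnW le_ij] := leqP (p j).1 (p i).1; [apply: H | apply/esym/H].
  move: le_ji; rewrite leq_eqVlt => /orP [/eqP er|lt_ji].
    apply: inj_p; rewrite [p i]surjective_pairing [p j]surjective_pairing.
    move: eij; rewrite er => /addnI /eqP; rewrite eqn_pmul2r // => /eqP es.
    by congr pair; apply: val_inj.
  have lt_s : ((p i).2 < (p j).2)%N.
    by rewrite -(ltn_pmul2r c10) -(ltn_add2l ((p i).1 * c2)) eij ltn_add2r ltn_pmul2r.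
  have [k ek] : exists k, ((p i).1 = (p j).1 + k :> nat)%N.
    by exists ((p i).1 - (p j).1)%N; rewrite subnKC // ltnW.
  have [k' ek'] : exists k', ((p j).2 = (p i).2 + k' :> nat)%N.
    by exists ((p j).2 - (p i).2)%N; rewrite subnKC // ltnW.
  have k0 : (0 < k)%N by move: lt_ji; rewrite ek -{1}[X in (X < _)%N]addn0 ltn_add2l.
  have ekk : (k * b2 = k' * b1)%N.
    rewrite ed1 ed2 !mulnA; congr (_ * _)%N.
    by move: eij; rewrite ek ek' !mulnDl -addnA => /addnI; rewrite addnC => /addnI.
  have hg : (g %| a1%:Z ^+ k - a2%:Z ^+ k')%Z.
    have := hcl i j; rewrite ek ek' !exprD.
    rewrite (_ : _ - _ = a1%:Z ^+ (p j).1 * a2%:Z ^+ (p i).2 * (a1%:Z ^+ k - a2%:Z ^+ k')); last by ring.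
    by rewrite Gauss_dvdzr.
  have := coincidence_bound pl la2 h1 h2 co b10 b20 k0 ekk hg hM.
  move=> hle; exfalso; move: hle; apply/negP; rewrite -ltnNge.
  have kn : (k < n)%N by apply: leq_ltn_trans (ltn_ord (p i).1); rewrite ek leq_addl.
  have kn' : (k' < n)%N by apply: leq_ltn_trans (ltn_ord (p j).2); rewrite ek' leq_addl.
  apply: (@leq_ltn_trans (2 ^ chi * 2 ^ (h * n))%N).
    apply: leq_mul => //; rewrite geq_max; apply/andP; split.
      apply: (@leq_trans ((2 ^ h) ^ k)%N); first by rewrite leq_exp2r.
      by rewrite -expnM leq_exp2l // leq_mul2l ltnW ?orbT.
    apply: (@leq_trans ((2 ^ h) ^ k')%N); first by case: (k') => // k''; rewrite leq_exp2r.
    by rewrite -expnM leq_exp2l // leq_mul2l ltnW ?orbT.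
  rewrite -expnD; apply: (@leq_trans (2 ^ M)%N).
    by rewrite ltn_exp2l //; apply: leq_trans hMN; rewrite addnC ltn_add2r.
  by case: (M) => // m; rewrite leq_exp2r.
have inj_p' : injective (fun i => (val (p i).1, val (p i).2)).
  move=> i j /= [/val_inj e1 /val_inj e2]; apply: inj_p.
  by rewrite [p i]surjective_pairing e1 e2 -surjective_pairing.
have [e [f]] := grid_determinant K0 L0 h1 h2 co inj_p' inj_x.
cbv zeta.
set r := (fun j => ((p (f j).1).1 + (p (f j).2).1)%N).
set s := (fun j => ((p (f j).1).2 + (p (f j).2).2)%N).
set D := \det _ => D0.
have [kappa hkappa] := ht (r (Ordinal N0)) (s (Ordinal N0)).
(* Each evaluation point is a sum of two points of the chosen class, so all the values are congruent
   modulo [g] and a single [kappa] serves. *)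
have hdvd : (l%:Z ^+ 'C(N, 2) %| l%:Z ^+ (N * K) * D)%Z.
  apply: (@padic_det_dvd N K L l t kappa (fun j => r j * c2 + s j * c1)%N
     (fun j => (a1 ^ r j * a2 ^ s j)%N%:Z)) => j.
  apply: (@dvdz_trans (l%:Z ^+ M')); first exact: dvdz_exp2l.
  rewrite PoszM !Posz_exp; apply: hkappa; rewrite /r /s !exprD.
  rewrite [X in (_ %| X - _)%Z]mulrACA [X in (_ %| _ - X)%Z]mulrACA.
  by apply: dvdz_subM; apply: hcl.
have r_lt j : (r j <= 2 * n)%N by rewrite mul2n -addnn leq_add // ltnW.
have s_lt j : (s j <= 2 * n)%N by rewrite mul2n -addnn leq_add // ltnW.
have hu j : (r j * c2 + s j * c1 <= 2 ^ chi)%N.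
  apply: leq_trans hX; rewrite addnC mulnDr; apply: leq_add.
    by apply: leq_mul => //; rewrite ed1 leq_pmulr.
  by apply: leq_mul => //; rewrite ed2 leq_pmulr.
have hy j : (a1 ^ r j * a2 ^ s j <= 2 ^ (4 * h * n))%N.
  rewrite (_ : 4 * h * n = h * (2 * n) + h * (2 * n))%N; last by ring.
  by rewrite expnD; apply: leq_mul; apply: exp_le_pow2.
have hD : (`|D|%N <= 2 ^ (N * (chi + (chi * K + 4 * h * n * L))))%N.
  rewrite -lez_nat Posz_exp abszE.
  pose B : int := 2%:Z ^+ (chi * K + 4 * h * n * L).
  apply: le_trans (norm_det_le (b := fun=> B) _) _ => [i j|].
    rewrite mxE /B -!Posz_exp -PoszM ger0_norm // lez_nat expnD; apply: leq_mul.
      by apply: exp_le_pow2 => //; apply: ltnW.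
    by apply: exp_le_pow2 => //; apply: ltnW.
  have -> : 2%:Z ^+ (N * (chi + (chi * K + 4 * h * n * L))) = (2%:Z ^+ chi) ^+ N * B ^+ N.
    by rewrite -exprMn -exprD -exprM mulnC.
  rewrite prodr_const card_ord -NE.
  apply: ler_wpM2r; first by rewrite exprn_ge0 // exprn_ge0.
  rewrite -!Posz_exp natz lez_nat; apply: leq_trans (fact_le_exp N) _.
  by rewrite leq_exp2r.
have hC : ('C(N, 2) <= N * K + N * (chi + (chi * K + 4 * h * n * L)))%N.
  have [le_C|/ltnW lt_C] := leqP 'C(N, 2) (N * K)%N.
    by apply: leq_trans le_C _; rewrite leq_addr.
  rewrite -leq_subLR -(@leq_exp2l 2) //; apply: leq_trans hD.
  apply: (@leq_trans (l ^ ('C(N, 2) - N * K))%N).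
    by case: (_ - _)%N => // m; rewrite leq_exp2r.
  have lNK : l%:Z ^+ (N * K) != 0 by rewrite expf_neq0 // eqz_nat -lt0n (ltnW l1).
  have : (l%:Z ^+ ('C(N, 2) - N * K) %| D)%Z.
    by rewrite -(dvdz_mul2l lNK) -exprD subnKC.
  by rewrite dvdzE -Posz_exp absz_nat => /dvdn_leq; apply; rewrite absz_gt0.
have := dim_large chi g0 hh; rewrite -/N -/n -/L -/K ltnNge => /negP; apply.
(* [2 * 'C(N, 2)] equals [N * N.-1]; the factor [N] is then cancelled. *)
rewrite -(leq_pmul2l N0) -[X in (_ * X <= _)%N]bin1 mul_bin_diag.
apply: leq_trans (leq_mul (leqnn 2) hC) _.
rewrite -mulnDr mulnCA leq_mul2l; apply/orP; right; rewrite leq_mul2l /=.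
have lin : forall h' n' K' L' c, (K' + (c + (c * K' + 4 * h' * n' * L')) <=
    c + K' * c.+1 + L' * (8 * h' * n' + 2) + 2)%N by clear; lia.
exact: lin.
Qed.

(** * The archimedean lower bound for two logarithms *)

(** This does the work of a Schwarz lemma: the terms surviving in [det_sum_expand] use functions of
    total weight at least ['C(N, 2)], so the power of [rho] on the left is at most the product of
    theirs. *)
Lemma weighted_det_bound (F : realDomainType) (N : nat) (I : finType) (w : I -> nat)
    (rho : F) (c : 'I_N -> I -> F) (v : I -> 'I_N -> F) (V : I -> F) :
  1 <= rho -> (forall m, m < N -> #|[pred n | w n <= m]| <= m.+1)%N ->
  (forall n j, `|v n j| <= V n) -> (forall n, 0 <= V n) ->
  rho ^+ 'C(N, 2) * `|\det (\matrix_(i, j) \sum_n c i n * v n j)| <=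
  N`!%:R * \prod_i \sum_n `|c i n| * V n * rho ^+ w n.
Proof.
move=> rho1 hw hv V0; have rho0 : 0 <= rho := le_trans ler01 rho1.
rewrite det_sum_expand.
apply: (@le_trans _ _ (rho ^+ 'C(N, 2) * (\sum_(phi : {ffun 'I_N -> I} | injectiveb phi)
     (\prod_i `|c i (phi i)|) * (N`!%:R * \prod_i V (phi i))))).
  rewrite ler_wpM2l ?exprn_ge0 //; apply: le_trans (ler_norm_sum _ _ _) _.
  apply: ler_sum => phi _; rewrite normrM normr_prod ler_wpM2l ?prodr_ge0 //.
  by apply: norm_det_le => i j; rewrite mxE.
rewrite bigA_distr_bigA !big_distrr /= [leLHS]big_mkcond /=; apply: ler_sum => phi _.
have pos : 0 <= \prod_i (`|c i (phi i)| * V (phi i) * rho ^+ w (phi i)).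
  by apply: prodr_ge0 => i _; rewrite !mulr_ge0 // exprn_ge0.
case: ifP => [/injectiveP inj_phi|_]; last by rewrite mulr_ge0.
rewrite !big_split /= -expr_sum.
set P := \prod_i `|_|; set Q := \prod_i V _.
rewrite [leLHS](_ : _ = N`!%:R * (P * Q * rho ^+ 'C(N, 2))); last by ring.
rewrite ler_wpM2l // ler_wpM2l ?mulr_ge0 ?prodr_ge0 //.
by apply: ler_weXn2l => //; apply: weight_sum_ge.
Qed.

Lemma expR_partial_sum_le (R : realType) (x : R) (T : nat) : 0 <= x ->
  \sum_(m < T) x ^+ m / m`!%:R <= expR x.
Proof.
move=> x0; have := @nondecreasing_cvgn_le R (series (exp_coeff x)) _ (is_cvg_series_exp_coeff x) T.
rewrite /series /= big_mkord; apply.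
apply/nondecreasing_seqP => n; rewrite /series /= big_nat_recr //= lerDl.
exact: exp_coeff_ge0.
Qed.

Lemma expR_partial_sum_close (R : realType) (x eps : R) : 0 < eps ->
  exists T, forall T', (T <= T')%N -> `|expR x - \sum_(m < T') x ^+ m / m`!%:R| <= eps.
Proof.
move=> eps0; have : (series (exp_coeff x) @ \oo --> expR x)%classic by apply: is_cvg_series_exp_coeff.
move/cvgrPdist_le => /(_ _ eps0) [T _ hT]; exists T => T' /hT.
by rewrite /series /= big_mkord.
Qed.

Lemma sum_shifted_monomials (F : comNzRingType) (f : nat -> F) (k S : nat) (z : F) : (k <= S)%N ->
  \sum_(m < S) (if (k <= m)%N then f (m - k)%N else 0) * z ^+ m =
  z ^+ k * \sum_(m < S - k) f m * z ^+ m.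
Proof.
move=> hk; rewrite -(big_mkord predT (fun m => (if (k <= m)%N then f (m - k)%N else 0) * z ^+ m)).
rewrite (@big_cat_nat _ _ _ k) //= big_nat big1 => [|m /andP [_ lt_mk]]; last first.
  by rewrite leqNgt lt_mk mul0r.
rewrite add0r -{1}[k]add0n big_addn big_mkord big_distrr /=; apply: eq_bigr => m _.
by rewrite leq_addl addnK exprD; ring.
Qed.

(** Each row is expanded as a truncated power series in the abscissa [u j]. The truncation error and
    the distance from [y j] to the exponential form [N] further functions of weight [N], and
    [weighted_det_bound] applies with [rho = 2]. *)
Lemma arch_det_bound (R : realType) (N K L : nat) (c X : R) (u y : 'I_N -> R)
    (e : 'I_N -> 'I_K * 'I_L) :
  0 <= c -> 1 <= X -> (forall j, 0 <= u j <= X) ->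
  (forall i j, `|u j ^+ (e i).1 * (y j ^+ (e i).2 - expR ((e i).2%:R * c * u j))| <= 2 ^- N) ->
  2 ^+ 'C(N, 2) * `|\det (\matrix_(i, j) (u j ^+ (e i).1 * y j ^+ (e i).2))| <=
  N`!%:R * ((2 * X) ^+ K * expR (L%:R * c * (2 * X)) + 2) ^+ N.
Proof.
move=> c0 X1 hu hy; have X0 : 0 < X := lt_le_trans ltr01 X1.
have u0 j : 0 <= u j by case/andP: (hu j).
have uX j : u j <= X by case/andP: (hu j).
(* The error of the exponential series is later multiplied by at most [X ^+ K]; the product must
   stay within [2 ^- N]. *)
pose eta : R := 2 ^- N / X ^+ K.
have eta0 : 0 < eta by rewrite divr_gt0 ?invr_gt0 ?exprn_gt0.
have [T hT] := fin_all_exists (fun i => fin_all_exists (fun j =>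
  expR_partial_sum_close ((e i).2%:R * c * u j) eta0)).
pose S := ((\max_i \max_j T i j) + K)%N.
have le_kS i : ((e i).1 <= S)%N by rewrite (leq_trans (ltnW (ltn_ord _))) // leq_addl.
have le_TS i j : (T i j <= S - (e i).1)%N.
  apply: (@leq_trans (\max_i \max_j T i j)).
    by apply: leq_trans (leq_bigmax (F := fun i => \max_j T i j) i); apply: leq_bigmax.
  by rewrite /S -addnBA ?leq_addr // ltnW.
pose f i m : R := ((e i).2%:R * c) ^+ m / m`!%:R.
pose coef i m := if ((e i).1 <= m)%N then f i (m - (e i).1)%N else 0.
pose r i j := u j ^+ (e i).1 * y j ^+ (e i).2 - \sum_(m < S) coef i m * u j ^+ m.
have f0 i m : 0 <= f i m by rewrite divr_ge0 ?exprn_ge0 ?mulr_ge0 ?ler0n.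
have coef0 i m : 0 <= coef i m by rewrite /coef; case: ifP.
have fE i m (z : R) : f i m * z ^+ m = ((e i).2%:R * c * z) ^+ m / m`!%:R.
  by rewrite /f mulrAC -exprMn.
have hr i j : `|r i j| <= 2 * 2 ^- N.
  rewrite /r sum_shifted_monomials // -mulrBr.
  under eq_bigr => m _ do rewrite fE.
  set s := \sum_(_ < _) _; set E := expR ((e i).2%:R * c * u j).
  have -> : u j ^+ (e i).1 * (y j ^+ (e i).2 - s) =
     u j ^+ (e i).1 * (y j ^+ (e i).2 - E) + u j ^+ (e i).1 * (E - s) by ring.
  apply: le_trans (ler_normD _ _) _; rewrite [2 * _]mulr_natl mulr2n; apply: lerD.
    exact: hy.
  rewrite normrM; have -> : 2 ^- N = X ^+ K * eta by rewrite /eta mulrC divfK ?expf_neq0 ?gt_eqF.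
  apply: ler_pM => //; last exact: hT.
  rewrite ger0_norm ?exprn_ge0 //; apply: le_trans (_ : X ^+ (e i).1 <= _).
    by apply: lerXn2r; rewrite ?nnegrE // ltW.
  by apply: ler_weXn2l => //; apply: ltnW.
pose w (n : 'I_S + 'I_N) := if n is inl k then k : nat else N.
pose c' i (n : 'I_S + 'I_N) : R := match n with inl m => coef i m | inr i' => (i == i')%:R end.
pose v (n : 'I_S + 'I_N) j : R := match n with inl m => u j ^+ m | inr i => r i j end.
pose V (n : 'I_S + 'I_N) : R := match n with inl m => X ^+ m | inr i => 2 * 2 ^- N end.
rewrite [X in `|\det X|](_ : _ = \matrix_(i, j) \sum_n c' i n * v n j); last first.
  apply/matrixP => i j; rewrite !mxE big_sumType /=.
  have -> : \sum_i' (i == i')%:R * r i' j = r i j.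
    rewrite (bigD1 i) //= eqxx mul1r big1 ?addr0 // => i' /negPf ne.
    by rewrite [i == i']eq_sym ne mul0r.
  by rewrite addrC subrK.
apply: le_trans (@weighted_det_bound R N _ w 2 c' v V _ _ _ _) _.
- by rewrite ler1n.
- exact: card_weight_sum.
- case=> [m|i] j /=; last exact: hr.
  by rewrite ger0_norm ?exprn_ge0 //; apply: lerXn2r; rewrite ?nnegrE // ltW.
- by case=> [m|i] /=; rewrite ?mulr_ge0 ?invr_ge0 ?exprn_ge0 // ltW.
rewrite ler_wpM2l // -[X in _ <= _ ^+ X]card_ord -prodr_const; apply: ler_prod => i _.
apply/andP; split.
  by apply: sumr_ge0 => -[m|i'] _ /=; rewrite !mulr_ge0 ?exprn_ge0 ?invr_ge0 ?exprn_ge0 // ltW.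
rewrite big_sumType /=; apply: lerD.
  under eq_bigr => m _ do rewrite ger0_norm // -mulrA -exprMn [X * 2]mulrC.
  rewrite sum_shifted_monomials //; apply: ler_pM.
  - by rewrite exprn_ge0 // mulr_ge0 // ltW.
  - by apply: sumr_ge0 => m _; rewrite mulr_ge0 // exprn_ge0 // mulr_ge0 // ltW.
  - by apply: ler_weXn2l; [have := X1; lra | apply: ltnW].
  under eq_bigr => m _ do rewrite fE.
  apply: le_trans (expR_partial_sum_le _ _) _.
    by rewrite !mulr_ge0 // ltW.
  rewrite ler_expR ler_wpM2r ?mulr_ge0 ?(ltW X0) // ler_wpM2r // ler_nat.
  exact: ltnW.
have -> : \sum_i' `|(i == i')%:R| * (2 * 2 ^- N) * 2 ^+ N = 2 :> R.
  rewrite (bigD1 i) //= eqxx normr1 mul1r big1 ?addr0; last first.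
    by move=> i' /negPf ne; rewrite [i == i']eq_sym ne normr0 !mul0r.
  by rewrite -mulrA mulVf ?expf_neq0 // mulr1.
by [].
Qed.

(** Distinct integers differ by at least 1, and ln (C / A) <= C / A - 1. *)
Lemma ln_ratio_ge (R : realType) (A C : nat) : (0 < C)%N -> (C < A)%N ->
  1 <= A%:R * (ln A%:R - ln C%:R : R).
Proof.
move=> C0 ltCA; have A0 : (0 < A)%N := leq_trans C0 (ltnW ltCA).
have AR : 0 < A%:R :> R by rewrite ltr0n.
have CR : 0 < C%:R :> R by rewrite ltr0n.
have h : ln (C%:R / A%:R : R) <= C%:R / A%:R - 1.
  rewrite -{1}[C%:R / A%:R](subrKC 1); apply: le_ln1Dx.
  by rewrite ltrBrDl subrr divr_gt0.
rewrite ln_div ?posrE // in h.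
have : A%:R * (1 - C%:R / A%:R) <= A%:R * (ln A%:R - ln C%:R) :> R.
  by rewrite ler_pM2l //; move: h; lra.
apply: le_trans; rewrite mulrBr mulr1 mulrCA divff ?gt_eqF // mulr1.
by rewrite lerBrDl natr1 ler_nat.
Qed.

Lemma expR_le2 (R : realType) (t : R) : t <= 1 / 2 -> expR t <= 2.
Proof.
move=> ht; have := expR_ge1Dx (- t); rewrite expRN => h.
have e0 := expR_gt0 t.
have : 2^-1 <= (expR t)^-1 by lra.
by rewrite lef_pV2 // posrE.
Qed.

Lemma box_degY_le_dim (h chi : nat) : (0 < h)%N ->
  (2 * box_side 1 h chi * degY chi <= det_dim 1 h chi)%N.
Proof.
move=> h0; rewrite /det_dim /degX /box_side.
rewrite [X in (X <= _)%N](_ : _ = 128 * (h * degY chi * degY chi))%N; last by ring.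
rewrite [X in (_ <= X)%N](_ : _ = (4096 * h) * (h * degY chi * degY chi))%N; last by ring.
by rewrite leq_mul // (@leq_trans (4096 * 1)) // leq_mul.
Qed.

(** At the abscissa r * b2 + s * b1 the function exp (z * ln a1 / b2) differs from [a1 ^ r * a2 ^ s]
    by the factor exp (s * lam / b2), where [lam] is the linear form. If [lam] is tiny,
    [arch_det_bound] makes a nonzero integer determinant too small. *)
Theorem arch_two_logs (R : realType) (a1 a2 b1 b2 h chi : nat) :
  coprime a1 a2 -> (1 < a1)%N -> (1 < a2)%N -> (a1 <= 2 ^ h)%N -> (a2 <= 2 ^ h)%N ->
  (0 < b1)%N -> (0 < b2)%N ->
  (det_dim 1 h chi <= 2 ^ chi)%N -> (2 * box_side 1 h chi * (b1 + b2) <= 2 ^ chi)%N ->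
  0 < b1%:R * ln a1%:R - b2%:R * ln a2%:R :> R ->
  1 <= (b1%:R * ln a1%:R - b2%:R * ln a2%:R) * 2 ^+ (2 * det_dim 1 h chi + chi) :> R.
Proof.
move=> co h1 h2 ha1 ha2 b10 b20.
set n := box_side 1 h chi; set N := det_dim 1 h chi => hN hX.
set lam : R := _ - _ => lam0; rewrite leNgt; apply/negP => hlam.
have hh : (0 < h)%N by case: (h) ha1 => //; rewrite expn0 leqNgt h1.
pose K := degX 1 h chi; pose L := degY chi.
have NE : N = (K * L)%N by [].
have L0 : (0 < L)%N by [].
have K0 : (0 < K)%N by apply: degX_gt0.
have N0 : (0 < N)%N by rewrite NE muln_gt0 K0 L0.
have n0 : (0 < n)%N by apply: box_side_gt0.
have lt_nN : (h * n < N)%N := box_side_lt_dim chi (isT : 0 < 1)%N hh.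
have a10 : 0 < a1%:R :> R by rewrite ltr0n ltnW.
have a20 : 0 < a2%:R :> R by rewrite ltr0n ltnW.
have b1R : 0 < b1%:R :> R by rewrite ltr0n.
have b2R : 0 < b2%:R :> R by rewrite ltr0n.
have b1R1 : 1 <= b1%:R :> R by rewrite ler1n.
have b2R1 : 1 <= b2%:R :> R by rewrite ler1n.
have small (k m : nat) : (k <= 2 ^ chi)%N -> (m <= 2 * N)%N -> k%:R * lam * 2 ^+ m < 1.
  move=> hk hm; apply: le_lt_trans hlam; rewrite [k%:R * _]mulrC -mulrA ler_pM2l //.
  rewrite addnC exprD; apply: ler_pM => //; first by rewrite -natrX ler_nat.
  by rewrite ler_weXn2l // ler1n.
have le_nchi : (n <= 2 ^ chi)%N.
  by apply: leq_trans hX; rewrite -mulnA mulnCA leq_pmulr // muln_gt0 addn_gt0 b10.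
have [|c [p [inj_p _]]] := @pigeonhole_class _ 1 N (fun _ : 'I_n * 'I_n => ord0) isT N0.
  by rewrite card_prod !card_ord -box_side_sqr.
(* Equal abscissas would give distinct powers of [a1] and [a2] whose logarithms differ by at most
   [k * lam], against [ln_ratio_ge]. *)
have inj_x : injective (fun i => (p i).1 * b2 + (p i).2 * b1)%N.
  move=> i j; wlog le_ji : i j / ((p j).1 <= (p i).1)%N => [H|] /= eij.
    by have [le_ji|/ltnW le_ij] := leqP (p j).1 (p i).1; [apply: H | apply/esym/H].
  move: le_ji; rewrite leq_eqVlt => /orP [/eqP er|lt_ji].
    apply: inj_p; rewrite [p i]surjective_pairing [p j]surjective_pairing.
    move: eij; rewrite er => /addnI /eqP; rewrite eqn_pmul2r // => /eqP es.
    by congr pair; apply: val_inj.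
  have lt_s : ((p i).2 < (p j).2)%N.
    by rewrite -(ltn_pmul2r b10) -(ltn_add2l ((p i).1 * b2)) eij ltn_add2r ltn_pmul2r.
  have [k ek] : exists k, ((p i).1 = (p j).1 + k :> nat)%N.
    by exists ((p i).1 - (p j).1)%N; rewrite subnKC // ltnW.
  have [k' ek'] : exists k', ((p j).2 = (p i).2 + k' :> nat)%N.
    by exists ((p j).2 - (p i).2)%N; rewrite subnKC // ltnW.
  have k0 : (0 < k)%N by move: lt_ji; rewrite ek -{1}[X in (X < _)%N]addn0 ltn_add2l.
  have ekk : (k * b2 = k' * b1)%N.
    by move: eij; rewrite ek ek' !mulnDl -addnA => /addnI; rewrite addnC => /addnI.
  have kn : (k < n)%N by apply: leq_ltn_trans (ltn_ord (p i).1); rewrite ek leq_addl.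
  exfalso.
  have ekR : k%:R * b2%:R = k'%:R * b1%:R :> R by rewrite -!natrM ekk.
  have kR : 0 < k%:R :> R by rewrite ltr0n.
  have klam : b1%:R * (ln (a1 ^ k)%:R - ln (a2 ^ k')%:R) = k%:R * lam :> R.
    rewrite !natrX !lnXn // -[ln a1%:R *+ k]mulr_natl -[ln a2%:R *+ k']mulr_natl /lam.
    by rewrite !mulrBr mulrA [b1%:R * (k'%:R * _)]mulrA [b1%:R * k'%:R]mulrC -ekR; ring.
  have d0 : 0 < ln (a1 ^ k)%:R - ln (a2 ^ k')%:R :> R.
    by rewrite -(pmulr_rgt0 _ b1R) klam mulr_gt0.
  have lt_CA : (a2 ^ k' < a1 ^ k)%N.
    by rewrite -(ltr_nat R) -ltr_ln ?posrE ?ltr0n ?expn_gt0 ?(ltnW h1) ?(ltnW h2) // -subr_gt0.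
  have := ln_ratio_ge R (_ : 0 < a2 ^ k')%N lt_CA; rewrite expn_gt0 (ltnW h2) => /(_ isT).
  apply/negP; rewrite -ltNge.
  apply: le_lt_trans (small n (h * n)%N le_nchi _); last first.
    by apply: leq_trans (ltnW lt_nN) _; rewrite leq_pmull.
  rewrite mulrC; apply: ler_pM => //; first exact: ltW.
    apply: (@le_trans _ _ (k%:R * lam)).
      by rewrite -klam ler_peMl // ltW.
    by rewrite ler_pM2r // ler_nat ltnW.
  by rewrite -natrX ler_nat; apply: exp_le_pow2 => //; apply: ltnW.
have inj_p' : injective (fun i => (val (p i).1, val (p i).2)).
  move=> i j /= [/val_inj e1 /val_inj e2]; apply: inj_p.
  by rewrite [p i]surjective_pairing e1 e2 -surjective_pairing.
have [e [f]] := grid_determinant K0 L0 h1 h2 co inj_p' inj_x.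
cbv zeta.
set r := (fun j => ((p (f j).1).1 + (p (f j).2).1)%N).
set s := (fun j => ((p (f j).1).2 + (p (f j).2).2)%N).
have r_lt j : (r j <= 2 * n)%N by rewrite mul2n -addnn leq_add // ltnW.
have s_lt j : (s j <= 2 * n)%N by rewrite mul2n -addnn leq_add // ltnW.
set D := \det _ => D0.
pose X : R := (2 * n * (b1 + b2))%N%:R.
pose cc : R := ln a1%:R / b2%:R.
(* [tau] bounds the discrepancy in the exponent over all points and all powers below [L]. *)
pose tau : R := (2 * n * L)%N%:R * lam.
have tau0 : 0 <= tau by rewrite mulr_ge0 // ltW.
have tau_small : tau * 2 ^+ (2 * N) < 1.
  by apply: small => //; apply: leq_trans hN; apply: box_degY_le_dim.
have tau4 : tau <= 1 / 4.
  have : 2 ^+ 2 <= 2 ^+ (2 * N) :> R by rewrite ler_weXn2l ?ler1n // leq_pmulr.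
  by move=> h4; have := ler_wpM2l tau0 h4; move: tau_small; rewrite expr2; clear; lra.
have la0 : 0 <= ln a1%:R :> R by rewrite ln_ge0 // ler1n ltnW.
have lb0 : 0 <= ln a2%:R :> R by rewrite ln_ge0 // ler1n ltnW.
have cc0 : 0 <= cc by rewrite divr_ge0.
have X1 : 1 <= X by rewrite ler1n muln_gt0 addn_gt0 b10 muln_gt0 n0.
have Xchi : X <= 2 ^+ chi by rewrite -natrX ler_nat.
have lamb2 : lam / b2%:R <= lam by rewrite ler_pdivrMr // ler_peMr // ltW.
have lamb20 : 0 <= lam / b2%:R by rewrite divr_ge0 // ltW.
have uE j : cc * (r j * b2 + s j * b1)%N%:R =
    (r j)%:R * ln a1%:R + (s j)%:R * ln a2%:R + (s j)%:R * (lam / b2%:R).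
  by rewrite /cc /lam natrD !natrM; field; rewrite gt_eqF.
have XE : cc * X = (2 * n)%N%:R * (ln a1%:R + ln a2%:R) + (2 * n)%N%:R * (lam / b2%:R).
  by rewrite /cc /lam /X !natrM natrD; field; rewrite gt_eqF.
have hexp q : expR ((L * q)%N%:R * (ln a1%:R + ln a2%:R)) <= 2 ^+ (2 * h * (L * q)) :> R.
  rewrite expRM_natl expRD !lnK ?posrE // -natrM -!natrX ler_nat.
  apply: exp_le_pow2 => //; rewrite mul2n -addnn expnD; exact: leq_mul.
have E1 : expR (L%:R * cc * X) <= 2 ^+ (4 * h * n * L + 1).
  rewrite -mulrA XE mulrDr mulrA -natrM expRD [(_ + 1)%N]addn1 exprSr; apply: ler_pM; rewrite ?expR_ge0 //.
    by apply: le_trans (hexp _) _; rewrite ler_weXn2l ?ler1n //; apply: eq_leq; ring.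
  apply: expR_le2; apply: (@le_trans _ _ tau); last by lra.
  by rewrite mulrA -natrM /tau [(L * _)%N]mulnC ler_wpM2l.
have E2 : expR (L%:R * cc * (2 * X)) <= 2 ^+ (8 * h * n * L + 1).
  have -> : L%:R * cc * (2 * X) = (L * (4 * n))%N%:R * (ln a1%:R + ln a2%:R) +
      2 * ((2 * n * L)%N%:R * (lam / b2%:R)).
    transitivity (2 * L%:R * (cc * X)); first by ring.
    by rewrite XE !natrM; ring.
  rewrite expRD [(_ + 1)%N]addn1 exprSr; apply: ler_pM; rewrite ?expR_ge0 //.
    by apply: le_trans (hexp _) _; rewrite ler_weXn2l ?ler1n //; apply: eq_leq; ring.
  apply: expR_le2; have : (2 * n * L)%N%:R * (lam / b2%:R) <= tau by rewrite ler_wpM2l.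
  by lra.
have large := dim_large chi (isT : 0 < 1)%N hh.
rewrite -/N -/n -/L -/K in large.
have hu j : (r j * b2 + s j * b1 <= 2 * n * (b1 + b2))%N.
  by rewrite addnC mulnDr leq_add // leq_mul.
have := @arch_det_bound R N K L cc X (fun j => (r j * b2 + s j * b1)%N%:R)
  (fun j => (a1 ^ r j * a2 ^ s j)%N%:R) e cc0 X1 _ _.
move=> /(_ (fun j => ltac:(by rewrite ler0n ler_nat hu))).
rewrite (_ : \det _ = D%:~R); last first.
  have mX (z : int) k : (z ^+ k)%:~R = z%:~R ^+ k :> R by rewrite rmorphXn.
  by rewrite /D -det_map_mx; congr (\det _); apply/matrixP => i j; rewrite !mxE /= intrM !mX.
set herr := (X in (X -> _) -> _).
have err : herr.
  move=> i j.
  set uj : R := (_ + _)%N%:R; set l := (e i).2.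
  set lj : R := (r j)%:R * ln a1%:R + (s j)%:R * ln a2%:R.
  have yE : (a1 ^ r j * a2 ^ s j)%N%:R = expR lj.
    by rewrite /lj expRD !expRM_natl !lnK ?posrE // natrM !natrX.
  pose delta : R := l%:R * ((s j)%:R * (lam / b2%:R)).
  have delta0 : 0 <= delta by apply: mulr_ge0 => //; apply: mulr_ge0.
  have delta_tau : delta <= tau.
    rewrite /delta mulrA -natrM /tau; apply: ler_pM => //.
    by rewrite ler_nat mulnC leq_mul // ltnW.
  have zE : l%:R * cc * uj = l%:R * lj + delta by rewrite -mulrA uE mulrDr.
  have uj0 : 0 <= uj by rewrite ler0n.
  have uX : uj <= X by rewrite ler_nat hu.
  have zX : expR (l%:R * cc * uj) <= 2 ^+ (4 * h * n * L + 1).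
    apply: le_trans E1; rewrite ler_expR; apply: ler_pM => //; first exact: mulr_ge0.
    by rewrite ler_wpM2r // ler_nat ltnW.
  have yl : expR lj ^+ l = expR (l%:R * cc * uj) * expR (- delta).
    by rewrite -expRM_natl -expRD zE addrK.
  rewrite yE yl -{2}[expR (l%:R * cc * uj)]mulr1 -mulrBr !normrM.
  rewrite (ger0_norm (exprn_ge0 _ uj0)) (ger0_norm (expR_ge0 _)).
  have hd : `|expR (- delta) - 1| <= tau.
    rewrite ler0_norm ?subr_le0 ?expR_le1 ?oppr_le0 //.
    by have := expR_ge1Dx (- delta); move: delta_tau; clear; lra.
  have hu' : uj ^+ (e i).1 <= 2 ^+ (chi * K).
    rewrite exprM; apply: (@le_trans _ _ (X ^+ (e i).1)).
      by apply: lerXn2r; rewrite ?nnegrE // (le_trans ler01).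
    apply: (@le_trans _ _ (X ^+ K)); first by rewrite ler_weXn2l // ltnW.
    by apply: lerXn2r; rewrite ?nnegrE ?exprn_ge0 // (le_trans ler01).
  apply: (@le_trans _ _ (2 ^+ (chi * K) * (2 ^+ (4 * h * n * L + 1) * tau))).
    apply: ler_pM; [exact: exprn_ge0 | | exact: hu' |].
      by apply: mulr_ge0; rewrite ?expR_ge0.
    by apply: ler_pM; rewrite ?expR_ge0.
  (* Of the factor [2 ^+ (2 * N)] in [tau_small], one half absorbs the size of the entries and the
     other yields the error [2 ^- N]. *)
  rewrite mulrA -exprD; apply: (@le_trans _ _ (2 ^+ N * tau)).
    have lin : forall h' n' K' L' c N',
        (2 * (c + K' * c.+1 + L' * (8 * h' * n' + 2) + 2) < N'.-1)%N ->
        (c * K' + (4 * h' * n' * L' + 1) <= N')%N by clear; lia.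
    by rewrite ler_wpM2r // ler_weXn2l ?ler1n //; apply: lin large.
  rewrite -[leRHS]mul1r ler_pdivlMr ?exprn_gt0 // mulrAC -exprD addnn -mul2n mulrC.
  exact: ltW.
move=> /(_ err) hdet.
have bound : 2 ^+ 'C(N, 2) <= N`!%:R * ((2 * X) ^+ K * expR (L%:R * cc * (2 * X)) + 2) ^+ N.
  apply: le_trans hdet; rewrite ler_peMr ?exprn_ge0 //.
  by rewrite -intr_norm -[1]/(1%:~R) ler_int -gtz0_ge1 normr_gt0; apply: D0.
pose Q := (K * chi.+1 + 8 * h * n * L + 2)%N.
have hQ : (2 * X) ^+ K * expR (L%:R * cc * (2 * X)) + 2 <= 2 ^+ Q.
  have hXK : (2 * X) ^+ K <= 2 ^+ (K * chi.+1).
    have -> : 2 ^+ (K * chi.+1) = (2 ^+ chi.+1) ^+ K :> R by rewrite -exprM mulnC.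
    apply: lerXn2r; rewrite ?nnegrE ?exprn_ge0 ?mulr_ge0 ?(le_trans ler01 X1) //.
    by rewrite exprS ler_wpM2l.
  have := ler_pM (exprn_ge0 K (_ : 0 <= 2 * X)) (expR_ge0 _) hXK E2.
  rewrite mulr_ge0 ?(le_trans ler01 X1) // => /(_ isT).
  rewrite -exprD /Q addn1 addn2 addnS [_ ^+ _.+2]exprS => hle.
  have : 2 ^+ 1 <= 2 ^+ (K * chi.+1 + 8 * h * n * L).+1 :> R by rewrite ler_weXn2l ?ler1n.
  by rewrite expr1; move: hle; clear; lra.
have fact_le : N`!%:R <= (2 ^+ chi) ^+ N :> R.
  rewrite -!natrX ler_nat; apply: leq_trans (fact_le_exp N) _.
  by rewrite leq_exp2r.
have Q0 : 0 <= (2 * X) ^+ K * expR (L%:R * cc * (2 * X)) + 2.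
  by rewrite addr_ge0 // mulr_ge0 ?expR_ge0 // exprn_ge0 // mulr_ge0 // (le_trans ler01).
have hC : ('C(N, 2) <= (chi + Q) * N)%N.
  rewrite -(@leq_exp2l 2) // -(ler_nat R) !natrX; apply: le_trans bound _.
  have -> : 2 ^+ ((chi + Q) * N) = (2 ^+ chi) ^+ N * (2 ^+ Q) ^+ N :> R.
    by rewrite -exprMn -exprD -exprM.
  apply: ler_pM => //; first exact: exprn_ge0.
  by apply: lerXn2r; rewrite ?nnegrE ?exprn_ge0.
move: large; rewrite ltnNge => /negP; apply.
rewrite -(leq_pmul2l N0) -[X in (_ * X <= _)%N]bin1 mul_bin_diag.
apply: leq_trans (leq_mul (leqnn 2) hC) _.
rewrite [((chi + Q) * N)%N]mulnC mulnCA leq_mul2l; apply/orP; right.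
have lin : forall h' n' K' L' c, (2 * (c + (K' * c.+1 + 8 * h' * n' * L' + 2)) <=
    2 * (c + K' * c.+1 + L' * (8 * h' * n' + 2) + 2))%N by clear; lia.
exact: lin.
Qed.

(** * Bounds for the exponents in the equation *)

Lemma det_dim_le (g g' h chi : nat) : (g <= g')%N -> (det_dim g h chi <= det_dim g' h chi)%N.
Proof. by move=> hg; rewrite /det_dim /degX !leq_mul. Qed.

Lemma box_side_le (g g' h chi : nat) : (g <= g')%N -> (box_side g h chi <= box_side g' h chi)%N.
Proof. by move=> hg; rewrite /box_side !leq_mul. Qed.

Lemma padic_base_le (l w : nat) : (1 < w)%N -> (l <= w)%N -> (padic_base l <= 2 * w)%N.
Proof. by rewrite /padic_base; case: eqP => [->|_] h1 h2; lia. Qed.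

Lemma odd_sqr_mod4 (a : nat) : ~~ (2 %| a)%N -> (4 %| (a ^ 2)%N%:Z - 1)%Z.
Proof.
rewrite dvdn2 negbK => oa; rewrite -(odd_double_half a) oa /=.
apply/dvdzP; exists ((a./2)%:Z * (a./2).+1%:Z).
rewrite Posz_exp PoszD -mul2n PoszM -addn1 PoszD; ring.
Qed.

(** [padic_two_logs] is applied to the squares of the bases at a prime factor of [w]. Odd squares
    are 1 modulo 4, as required at the prime 2, and a congruence of squares also covers powers that
    are opposite modulo [w ^ m]. *)
Lemma padic_exponent_bound (w m a1 a2 b1 b2 h chi : nat) :
  (1 < w)%N -> (1 < a1)%N -> (1 < a2)%N ->
  coprime w a1 -> coprime w a2 -> coprime a1 a2 ->
  (a1 ^ 2 <= 2 ^ h)%N -> (a2 ^ 2 <= 2 ^ h)%N -> (0 < b1)%N -> (0 < b2)%N ->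
  (det_dim (2 * w) h chi <= 2 ^ chi)%N ->
  (2 * box_side (2 * w) h chi * (b1 + b2) <= 2 ^ chi)%N ->
  (w%:Z ^+ m %| (a1%:Z ^+ b1) ^+ 2 - (a2%:Z ^+ b2) ^+ 2)%Z ->
  (m < det_dim (2 * w) h chi + chi)%N.
Proof.
move=> w1 h1 h2 co1 co2 co ha1 ha2 b10 b20 hN hX hm.
set l := pdiv w; have pl : prime l by apply: pdiv_prime.
have lw : (l %| w)%N by apply: pdiv_dvd.
have ndvd a : coprime w a -> ~~ (l %| a)%N.
  by move=> coa; rewrite -prime_coprime //; apply: coprime_dvdl coa.
have hg : (padic_base l <= 2 * w)%N.
  by apply: padic_base_le => //; apply: dvdn_leq => //; apply: ltnW.
have la1 : ~~ (l %| a1 ^ 2)%N by rewrite Euclid_dvdX // (negPf (ndvd _ co1)).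
have la2 : ~~ (l %| a2 ^ 2)%N by rewrite Euclid_dvdX // (negPf (ndvd _ co2)).
have sqr1 a : (1 < a)%N -> (1 < a ^ 2)%N by move=> a1'; rewrite -{1}(exp1n 2) ltn_exp2r.
apply: (@leq_trans (det_dim (padic_base l) h chi + chi)%N).
  2: by rewrite leq_add2r det_dim_le.
apply: (@padic_two_logs l m (a1 ^ 2) (a2 ^ 2) b1 b2) => //.
- move=> l2; rewrite l2 in ndvd.
  by split; apply: odd_sqr_mod4; apply: ndvd.
- by rewrite coprimeXl // coprimeXr.
- exact: sqr1.
- exact: sqr1.
- by apply: leq_trans hN; apply: det_dim_le.
- by apply: leq_trans hX; rewrite leq_mul // leq_mul // box_side_le.
apply: (@dvdz_trans (w%:Z ^+ m)).
  by apply: dvdz_exp2r; rewrite dvdzE.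
by rewrite !Posz_exp -!exprM !(mulnC 2%N) !exprM.
Qed.

(** The linear form is ln (1 + X / a2 ^ b2), at most X / a2 ^ b2, so the lower bound gives z ^ r <=
    X * 2 ^ (2 * N + chi + 1) with N the dimension. Squaring and using [X ^ 2 <= z ^ r] eliminates
    [X]. *)
Lemma arch_exponent_bound (R : realType) (X a2 b2 z r h chi : nat) :
  (1 < X)%N -> (1 < a2)%N -> (1 < z)%N -> coprime z a2 ->
  (z <= 2 ^ h)%N -> (a2 <= 2 ^ h)%N -> (0 < b2)%N -> (0 < r)%N ->
  (det_dim 1 h chi <= 2 ^ chi)%N -> (2 * box_side 1 h chi * (r + b2) <= 2 ^ chi)%N ->
  (X + a2 ^ b2 = z ^ r)%N -> (X ^ 2 <= z ^ r)%N ->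
  (z ^ r <= 2 ^ (4 * det_dim 1 h chi + 2 * chi + 2))%N.
Proof.
move=> X1 h2 z1 co hz ha2 b20 r0 hN hX e hXH.
set N := det_dim 1 h chi in hN *.
have A0 : (0 < a2 ^ b2)%N by rewrite expn_gt0 (ltnW h2).
have H0 : (0 < z ^ r)%N by rewrite expn_gt0 (ltnW z1).
have AR : 0 < (a2 ^ b2)%:R :> R by rewrite ltr0n.
have XR : 0 < X%:R :> R by rewrite ltr0n ltnW.
have lamE : r%:R * ln z%:R - b2%:R * ln a2%:R = ln (1 + X%:R / (a2 ^ b2)%:R) :> R.
  have -> : 1 + X%:R / (a2 ^ b2)%:R = (z ^ r)%:R / (a2 ^ b2)%:R :> R.
    by rewrite -e natrD mulrDl divff ?gt_eqF // addrC.
  rewrite ln_div ?posrE ?ltr0n // !natrX !lnXn ?ltr0n ?(ltnW z1) ?(ltnW h2) //.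
  by rewrite ![_%:R * _]mulr_natl.
have lam0 : 0 < r%:R * ln z%:R - b2%:R * ln a2%:R :> R.
  by rewrite lamE ln_gt0 // ltrDl divr_gt0.
have := arch_two_logs co z1 h2 hz ha2 r0 b20 hN hX lam0; rewrite -/N lamE => h1.
have {}h1 : (a2 ^ b2 <= X * 2 ^ (2 * N + chi))%N.
  rewrite -(ler_nat R) natrM [(2 ^ _)%:R]natrX -[leLHS]mul1r -ler_pdivlMr //.
  rewrite mulrAC; apply: le_trans h1 _; rewrite ler_wpM2r ?exprn_ge0 //.
  by apply: le_ln1Dx; rewrite (lt_trans _ (divr_gt0 XR AR)) // ltrN10.
have h2' : (z ^ r <= X * 2 ^ (2 * N + chi).+1)%N.
  by rewrite -e expnS mul2n -addnn mulnDr leq_add // leq_pmulr // expn_gt0.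
have : (z ^ r * z ^ r <= z ^ r * 2 ^ (4 * N + 2 * chi + 2))%N.
  apply: leq_trans (leq_mul h2' h2') _; rewrite mulnACA -expnD; apply: leq_mul => //.
  by rewrite leq_exp2l //; lia.
by rewrite leq_pmul2l.
Qed.

Lemma fermat_catalan_bound (R : realType) (x y z p q r w h chi : nat) :
  (1 < x)%N -> (1 < y)%N -> (1 < z)%N -> (0 < p)%N -> (0 < q)%N -> (0 < r)%N ->
  coprime x y -> coprime x z -> coprime y z -> (x ^ p + y ^ q = z ^ r)%N ->
  w = minn x (minn y z) ->
  (x ^ 2 <= 2 ^ h)%N -> (y ^ 2 <= 2 ^ h)%N -> (z ^ 2 <= 2 ^ h)%N ->
  (det_dim (2 * w) h chi <= 2 ^ chi)%N ->
  (2 * box_side (2 * w) h chi * (p + q + r) <= 2 ^ chi)%N ->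
  (z ^ r <= w ^ (4 * det_dim (2 * w) h chi + 2 * chi + 2))%N.
Proof.
move=> x1 y1 z1 p0 q0 r0 cxy cxz cyz e ew hx hy hz hN hX.
have w1 : (1 < w)%N by rewrite ew !leq_min x1 y1.
have g1 : (1 <= 2 * w)%N by rewrite muln_gt0 (ltnW w1).
have sq a : (1 < a)%N -> (a ^ 2 <= 2 ^ h)%N -> (a <= 2 ^ h)%N.
  by move=> a1; apply: leq_trans; rewrite -{1}[a]expn1 leq_exp2l.
have hN1 : (det_dim 1 h chi <= 2 ^ chi)%N by apply: leq_trans hN; apply: det_dim_le.
have hX1 (b : nat) : (b <= p + q + r)%N -> (2 * box_side 1 h chi * b <= 2 ^ chi)%N.
  move=> hb; apply: leq_trans hX; rewrite leq_mul // leq_mul //; exact: box_side_le.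
have hX2 (b : nat) : (b <= p + q + r)%N -> (2 * box_side (2 * w) h chi * b <= 2 ^ chi)%N.
  by move=> hb; apply: leq_trans hX; rewrite leq_mul.
have fin1 : (z ^ r <= 2 ^ (4 * det_dim 1 h chi + 2 * chi + 2))%N ->
    (z ^ r <= w ^ (4 * det_dim (2 * w) h chi + 2 * chi + 2))%N.
  move/leq_trans; apply; apply: (@leq_trans (w ^ (4 * det_dim 1 h chi + 2 * chi + 2))%N).
    by rewrite leq_exp2r // addn2.
  by rewrite leq_exp2l // !leq_add2r leq_mul2l det_dim_le.
have pow1 a b : (1 < a)%N -> (0 < b)%N -> (1 < a ^ b)%N by move=> *; rewrite -(exp1n b) ltn_exp2r.
have czx : coprime z x by rewrite coprime_sym.
have czy : coprime z y by rewrite coprime_sym.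
have cyx : coprime y x by rewrite coprime_sym.
have [le_x|lt_x] := leqP ((x ^ p) ^ 2)%N (z ^ r).
  have hb : (r + q <= p + q + r)%N by rewrite [(r + q)%N]addnC -addnA leq_addl.
  exact: fin1 (arch_exponent_bound R (pow1 _ _ x1 p0) y1 z1 czy (sq _ z1 hz) (sq _ y1 hy)
    q0 r0 hN1 (hX1 _ hb) e le_x).
have [le_y|lt_y] := leqP ((y ^ q) ^ 2)%N (z ^ r).
  have hb : (r + p <= p + q + r)%N by rewrite [(r + p)%N]addnC [X in (_ <= X)%N]addnAC leq_addr.
  have e' : (y ^ q + x ^ p = z ^ r)%N by rewrite addnC.
  exact: fin1 (arch_exponent_bound R (pow1 _ _ y1 q0) x1 z1 czx (sq _ z1 hz) (sq _ x1 hx)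
    p0 r0 hN1 (hX1 _ hb) e' le_y).
have lt_z : (z ^ r < (z ^ r) ^ 2)%N by rewrite -{1}[(z ^ r)%N]expn1 ltn_exp2l // pow1.
(* Here [w ^ m] stands for the power of [w] in the equation; it exceeds the square root of [z ^ r],
   so bounding [m] bounds [z ^ r]. *)
have fin2 m : (z ^ r < (w ^ m) ^ 2)%N -> (m < det_dim (2 * w) h chi + chi)%N ->
    (z ^ r <= w ^ (4 * det_dim (2 * w) h chi + 2 * chi + 2))%N.
  move=> hm lt_m; apply: leq_trans (ltnW hm) _; rewrite -expnM leq_exp2l //.
  by move: lt_m; move: (det_dim _ _ _) => N; clear; lia.
have eZ : x%:Z ^+ p + y%:Z ^+ q = z%:Z ^+ r by rewrite -!Posz_exp -PoszD e.
have [wx|wx] := eqVneq w x.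
  have hb : (q + r <= p + q + r)%N by rewrite -addnA leq_addl.
  have hm : (x%:Z ^+ p %| (y%:Z ^+ q) ^+ 2 - (z%:Z ^+ r) ^+ 2)%Z.
    by rewrite -eZ; apply/dvdzP; exists (- (x%:Z ^+ p + 2 * y%:Z ^+ q)); ring.
  apply: (fin2 p); rewrite wx in hN hX2 *; first exact: lt_x.
  exact: padic_exponent_bound x1 y1 z1 cxy cxz cyz hy hz q0 r0 hN (hX2 _ hb) hm.
have [wy|wy] := eqVneq w y.
  have hb : (p + r <= p + q + r)%N by rewrite [X in (_ <= X)%N]addnAC leq_addr.
  have hm : (y%:Z ^+ q %| (x%:Z ^+ p) ^+ 2 - (z%:Z ^+ r) ^+ 2)%Z.
    by rewrite -eZ; apply/dvdzP; exists (- (y%:Z ^+ q + 2 * x%:Z ^+ p)); ring.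
  apply: (fin2 q); rewrite wy in hN hX2 *; first exact: lt_y.
  exact: padic_exponent_bound y1 x1 z1 cyx cyz cxz hx hz p0 r0 hN (hX2 _ hb) hm.
have wz : w = z.
  move: wx wy; rewrite ew; clear.
  by case: (leqP y z) => _; case: (leqP x _) => _; rewrite ?eqxx.
have hm : (z%:Z ^+ r %| (x%:Z ^+ p) ^+ 2 - (y%:Z ^+ q) ^+ 2)%Z.
  by rewrite -eZ; apply/dvdzP; exists (x%:Z ^+ p - y%:Z ^+ q); ring.
apply: (fin2 r); rewrite wz in hN hX2 *; first exact: lt_z.
exact: padic_exponent_bound z1 x1 y1 czx czy cxy hx hy p0 q0 hN (hX2 _ (leq_addr _ _)) hm.
Qed.

(** * Explicit estimates and the choice of [h] and [chi] *)

Lemma expR1_ge (R : realType) : 5 / 2 <= expR 1 :> R.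
Proof.
have -> : 1 = 8%:R * (1 / 8) :> R by field.
rewrite expRM_natl; apply: (@le_trans _ _ ((9 / 8) ^+ 8)); first by rewrite !exprS expr0; lra.
by apply: lerXn2r; rewrite ?nnegrE ?expR_ge0 //; have := @expR_ge1Dx R (1 / 8); lra.
Qed.

Lemma ln2_ge (R : realType) : 1 / 2 <= ln 2 :> R.
Proof. by rewrite -ler_expR lnK ?posrE //; apply: expR_le2. Qed.

Lemma ln3_gt1 (R : realType) : 1 < ln 3 :> R.
Proof.
have e : expR 1 < 3 :> R.
  have -> : 1 = 8%:R * (1 / 8) :> R by field.
  rewrite expRM_natl; apply: (@le_lt_trans _ _ ((8 / 7) ^+ 8)); last by rewrite !exprS expr0; lra.
  apply: lerXn2r; rewrite ?nnegrE ?expR_ge0 //.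
  have := @expR_ge1Dx R (- (1 / 8)); rewrite expRN => h.
  have := ler_wpM2l (expR_ge0 (1 / 8)) h; rewrite divff ?expR_eq0 //; lra.
by rewrite -ltr_expR lnK ?posrE.
Qed.

Lemma expR_ge_lin (R : realType) (s : R) : 0 <= s -> 5 / 2 * s <= expR s.
Proof.
move=> s0; rewrite -(subrKC 1 s) expRD subrKC.
by apply: ler_pM => //; [apply: expR1_ge | have := expR_ge1Dx (s - 1); lra].
Qed.

(** For t = W / 10 this is 8 * t <= exp t, which follows from the tangent at 18/5 and exp (18/5) >=
    133/5. *)
Lemma expR_ge_pow10 (R : realType) (W : R) : 75 / 2 <= W -> (4 / 5 * W) ^+ 10 <= expR W.
Proof.
move=> hW; have -> : expR W = expR (W / 10) ^+ 10.
  by rewrite -expRM_natl; congr expR; field.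
apply: lerXn2r; rewrite ?nnegrE ?expR_ge0 //; first by rewrite mulr_ge0 //; lra.
set t := W / 10; have ht : 15 / 4 <= t by rewrite /t; lra.
have -> : 4 / 5 * W = 8 * t by rewrite /t; field.
have -> : t = 18 / 5 + (t - 18 / 5) by ring.
rewrite expRD; have h36 : 133 / 5 <= expR (18 / 5) :> R.
  have -> : 18 / 5 = 18%:R * (1 / 5) :> R by field.
  rewrite expRM_natl; apply: (@le_trans _ _ ((6 / 5) ^+ 18)); first by rewrite !exprS expr0; lra.
  by apply: lerXn2r; rewrite ?nnegrE ?expR_ge0 //; have := @expR_ge1Dx R (1 / 5); lra.
have h2 := expR_ge1Dx (t - 18 / 5).
apply: (@le_trans _ _ (133 / 5 * (1 + (t - 18 / 5)))); first by lra.
by apply: ler_pM => //; lra.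
Qed.

(** With s = ln u, the first bound comes from u >= 5/2 * s and the second from u >= 25/16 * s ^
    2. *)
Lemma log_quotient_bounds (R : realType) (u W : R) : 1 < u -> 15 * u / ln u < W ->
  75 / 2 <= W /\ 300 * u <= W ^+ 2.
Proof.
move=> u1; have u0 : 0 < u := lt_trans ltr01 u1.
have s0 : 0 < ln u by rewrite ln_gt0.
set s := ln u in s0 *; have us : u = expR s by rewrite lnK.
have h1 : 5 / 2 * s <= u by rewrite us; apply: expR_ge_lin; apply: ltW.
have h2 : 25 / 16 * s ^+ 2 <= u.
  have -> : u = expR (s / 2) ^+ 2 by rewrite us -expRM_natl; congr expR; field.
  have -> : 25 / 16 * s ^+ 2 = (5 / 2 * (s / 2)) ^+ 2 by field.
  apply: lerXn2r; rewrite ?nnegrE ?expR_ge0 //; first by rewrite !mulr_ge0 // ltW.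
  by apply: expR_ge_lin; rewrite divr_ge0 // ltW.
rewrite ltr_pdivrMr // => hW.
have W0 : 0 < W by rewrite -(pmulr_lgt0 _ s0); apply: le_lt_trans hW; rewrite mulr_ge0 // ltW.
split.
  by rewrite -(ler_pM2r s0); lra.
have hsq : (15 * u) ^+ 2 <= (W * s) ^+ 2.
  by apply: lerXn2r; rewrite ?nnegrE ?mulr_ge0 // ltW.
have s20 : 0 < s ^+ 2 by rewrite exprn_gt0.
rewrite -(ler_pM2r s20); rewrite !exprMn in hsq.
apply: le_trans hsq; rewrite !expr2 in h2 *.
have := ler_wpM2l (ltW u0) h2; nra.
Qed.

Lemma det_dimE (R : realType) (w h chi : nat) :
  (det_dim (2 * w) h chi)%:R = (32 * 4096) * w%:R * h%:R ^+ 2 * (chi%:R + 1) ^+ 2 :> R.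
Proof.
rewrite /det_dim /degX /degY.
by rewrite !(natrM, natrX) -[chi.+1]addn1 natrD; ring.
Qed.

Lemma box_sideE (R : realType) (w h chi P : nat) :
  (2 * box_side (2 * w) h chi * P)%:R = 1024 * w%:R * h%:R * (chi%:R + 1) * P%:R :> R.
Proof.
rewrite /box_side /degY.
by rewrite !natrM -[chi.+1]addn1 natrD; ring.
Qed.

(** [Y] will be the logarithm of [ln (z ^ r)]. As ln 2 >= 1/2, [2 ^ chi] is at least [expR Y ^+ 3].
    The two left sides are of order [expR Y * Y ^+ 4] and [expR Y ^+ 2 * Y ^+ 2], and [expR Y]
    exceeds a million times [Y ^+ 2]. *)
Lemma parameter_conditions (R : realType) (Y : R) (w h chi P : nat) :
  75 / 2 <= Y -> 6 * Y <= chi%:R <= 6 * Y + 1 -> w%:R <= expR Y -> h%:R <= 15 * Y ->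
  P%:R <= 6 * expR Y ->
  (det_dim (2 * w) h chi <= 2 ^ chi)%N /\ (2 * box_side (2 * w) h chi * P <= 2 ^ chi)%N.
Proof.
move=> hY /andP [hc1 hc2] hw hh hP.
have Y0 : 0 < Y by lra.
set E := expR Y in hw hP; have E0 : 0 < E := expR_gt0 Y.
have EY : 1000 * 1000 * Y ^+ 2 <= E.
  apply: le_trans (expR_ge_pow10 hY).
  have h30 : 30 ^+ 8 <= (4 / 5 * Y) ^+ 8.
    by apply: lerXn2r; rewrite ?nnegrE //; lra.
  have -> : (4 / 5 * Y) ^+ 10 = (4 / 5 * Y) ^+ 8 * (16 / 25) * Y ^+ 2.
    by field.
  rewrite ler_wpM2r ?sqr_ge0 //.
  have : 1000 * 1000 <= 30 ^+ 8 * (16 / 25) :> R by rewrite !exprS expr0; lra.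
  by move=> hc; apply: le_trans hc _; rewrite ler_wpM2r.
have hE : E ^+ 3 <= 2 ^+ chi.
  have -> : 2 ^+ chi = expR (chi%:R * ln 2) :> R by rewrite expRM_natl lnK ?posrE.
  rewrite /E -expRM_natl ler_expR.
  apply: (@le_trans _ _ (chi%:R * (1 / 2))); first by lra.
  by rewrite ler_wpM2l // ln2_ge.
have hch : chi%:R + 1 <= 7 * Y by lra.
have w0 : 0 <= w%:R :> R by [].
have h0 : 0 <= h%:R :> R by [].
have P0 : 0 <= P%:R :> R by [].
have c0 : 0 <= chi%:R + 1 :> R by rewrite addr_ge0.
have wh : w%:R * h%:R <= E * (15 * Y) by apply: ler_pM.
have whc : w%:R * h%:R * (chi%:R + 1) <= E * (15 * Y) * (7 * Y).
  by apply: ler_pM => //; apply: mulr_ge0.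
split; rewrite -(ler_nat R) natrX; apply: le_trans hE.
  rewrite det_dimE.
  have hc : h%:R * (chi%:R + 1) <= 15 * Y * (7 * Y) by apply: ler_pM.
  have A := ler_pM (mulr_ge0 (mulr_ge0 w0 h0) c0) (mulr_ge0 h0 c0) whc hc.
  have Y20 : 0 <= 1000 * 1000 * Y ^+ 2 by rewrite mulr_ge0 ?sqr_ge0.
  have B := ler_wpM2l (ltW E0) (ler_pM Y20 Y20 EY EY).
  have Y40 : 0 <= E * (Y ^+ 2 * Y ^+ 2) by rewrite !mulr_ge0 ?sqr_ge0 // ltW.
  apply: (@le_trans _ _ (32 * 4096 * (E * (15 * Y) * (7 * Y) * (15 * Y * (7 * Y))))).
    have -> : 32 * 4096 * w%:R * h%:R ^+ 2 * (chi%:R + 1) ^+ 2 =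
        32 * 4096 * (w%:R * h%:R * (chi%:R + 1) * (h%:R * (chi%:R + 1))) :> R by ring.
    have k0 : 0 <= 32 * 4096 :> R by apply: mulr_ge0; rewrite ler0n.
    exact: (ler_wpM2l k0 A).
  rewrite exprS expr2; apply: le_trans B.
  by move: Y40; clear; lra.
rewrite box_sideE.
have A := ler_pM (mulr_ge0 (mulr_ge0 w0 h0) c0) P0 whc hP.
have B := ler_wpM2l (mulr_ge0 (ltW E0) (ltW E0)) EY.
have Y20 : 0 <= E * E * Y ^+ 2 by rewrite !mulr_ge0 ?sqr_ge0 // ltW.
apply: (@le_trans _ _ (1024 * (E * (15 * Y) * (7 * Y) * (6 * E)))).
  have -> : 1024 * w%:R * h%:R * (chi%:R + 1) * P%:R =
      1024 * (w%:R * h%:R * (chi%:R + 1) * P%:R) :> R by ring.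
  exact: (ler_wpM2l (ler0n R 1024) A).
have -> : E ^+ 3 = E * E * E by ring.
apply: le_trans B.
by move: Y20; clear; lra.
Qed.

(** Let W = Y - u / 3 exceed 15 * u / ln u. Since w <= exp (u / 3), the last hypothesis bounds exp W
    by a constant times u ^ 3 * Y ^ 2. Both 300 * u and 35 * Y are at most W ^ 2, so exp W < W ^ 10
    / 100, against [expR_ge_pow10]. *)
Lemma loglog_bound (R : realType) (u Y : R) (w h chi : nat) :
  1 < u -> 6 * Y <= chi%:R <= 6 * Y + 1 -> h%:R <= 5 * u -> (0 < h)%N -> (1 < w)%N ->
  3 * ln w%:R <= u ->
  expR Y <= (4 * det_dim (2 * w) h chi + 2 * chi + 2)%N%:R * ln w%:R ->
  Y <= u / 3 + 15 * u / ln u.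
Proof.
move=> u1 /andP [hc1 hc2] hh h0 w1 hw hE; rewrite leNgt; apply/negP => hY.
pose W := Y - u / 3; have YW : Y = u / 3 + W by rewrite /W addrC subrK.
have [W1 W2] : 75 / 2 <= W /\ 300 * u <= W ^+ 2.
  by apply: log_quotient_bounds => //; rewrite /W; lra.
have W0 : 0 < W by lra.
have u0 : 0 < u by lra.
have Y1 : 75 / 2 <= Y by rewrite YW; lra.
have wR : 0 < w%:R :> R by rewrite ltr0n ltnW.
have w_le : w%:R <= expR (u / 3) by rewrite -ler_ln ?posrE ?expR_gt0 // expRK; lra.
have lw0 : 0 <= ln w%:R :> R by rewrite ln_ge0 // ler1n ltnW.
set N := det_dim _ _ _ in hE.
have chiN : (2 * chi + 2 <= N)%N.
  apply: (@leq_trans (degY chi)); first by rewrite /degY mulnS addnC leq_add // leq_mul2r orbT.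
  by rewrite /N /det_dim leq_pmull // degX_gt0 // muln_gt0 (ltnW w1).
have hN : N%:R <= (32 * 4096) * expR (u / 3) * (5 * u) ^+ 2 * (7 * Y) ^+ 2.
  have k0 : 0 <= 32 * 4096 :> R by apply: mulr_ge0; rewrite ler0n.
  have h2 : h%:R ^+ 2 <= (5 * u) ^+ 2.
    by apply: lerXn2r; rewrite ?nnegrE ?ler0n // (le_trans (ler0n _ h)).
  have chi2 : (chi%:R + 1) ^+ 2 <= (7 * Y) ^+ 2.
    by apply: lerXn2r; rewrite ?nnegrE ?addr_ge0 ?ler0n //; move: hc2 Y1; clear; lra.
  have wh := ler_pM (mulr_ge0 k0 (ler0n R w)) (sqr_ge0 _) (ler_wpM2l k0 w_le) h2.
  rewrite det_dimE.
  exact: (ler_pM (mulr_ge0 (mulr_ge0 k0 (ler0n R w)) (sqr_ge0 _)) (sqr_ge0 _) wh chi2).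
have E3 : expR (u / 3) > 0 := expR_gt0 _.
have main : expR W <= (270 * 1000 * 1000) * u ^+ 3 * Y ^+ 2.
  rewrite -(ler_pM2l E3) -expRD -YW; apply: le_trans hE _.
  apply: (@le_trans _ _ (5 * N%:R * (u / 3))).
    apply: ler_pM => //; last by lra.
    by rewrite -addnA natrD natrM; have : (2 * chi + 2)%N%:R <= N%:R :> R by [rewrite ler_nat]; lra.
  have u30 : 0 <= u / 3 by rewrite divr_ge0 // ltW.
  have := ler_wpM2r u30 hN.
  have pos : 0 <= expR (u / 3) * (u ^+ 3 * Y ^+ 2).
    by apply: mulr_ge0; rewrite ?(ltW E3) // mulr_ge0 ?sqr_ge0 // exprn_ge0 // ltW.
  by move: pos; rewrite !expr2 !exprS expr0; clear; lra.
have hu3 : (27 * 1000 * 1000) * u ^+ 3 <= W ^+ 6.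
  have -> : (27 * 1000 * 1000) * u ^+ 3 = (300 * u) ^+ 3 by ring.
  have -> : W ^+ 6 = (W ^+ 2) ^+ 3 by rewrite -exprM.
  by apply: lerXn2r; rewrite ?nnegrE ?sqr_ge0 //; move: u0 Y1; clear; lra.
have hY2 : 35 * Y <= W ^+ 2.
  by rewrite YW; move: W1 W2; rewrite !expr2; clear; nra.
have hY4 : 1225 * Y ^+ 2 <= W ^+ 4.
  have -> : 1225 * Y ^+ 2 = (35 * Y) ^+ 2 by ring.
  have -> : W ^+ 4 = (W ^+ 2) ^+ 2 by rewrite -exprM.
  by apply: lerXn2r; rewrite ?nnegrE ?sqr_ge0 //; move: u0 Y1; clear; lra.
have u3 : 0 <= u ^+ 3 by rewrite exprn_ge0 // ltW.
have k27 : 0 <= 27 * 1000 * 1000 :> R by rewrite !mulr_ge0 ?ler0n.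
have A := ler_pM (mulr_ge0 k27 u3) (mulr_ge0 (ler0n R 1225) (sqr_ge0 Y)) hu3 hY4.
have B := expR_ge_pow10 W1.
have W10 : 0 < W ^+ 10 by rewrite exprn_gt0.
have eA : W ^+ 6 * W ^+ 4 = W ^+ 10 by rewrite -exprD.
have eB : (4 / 5 * W) ^+ 10 = (4 / 5) ^+ 10 * W ^+ 10 by rewrite exprMn.
have hc : 1 / 100 <= (4 / 5) ^+ 10 :> R by clear; rewrite !exprS expr0; lra.
have C := ler_wpM2r (ltW W10) hc.
rewrite eA in A; rewrite eB in B.
have D := le_trans C (le_trans B main).
have pos : 0 < u ^+ 3 * Y ^+ 2 by rewrite mulr_gt0 // exprn_gt0 //; move: u0 Y1; clear; lra.
by move: pos A D; clear; lra.
Qed.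

Lemma loglog_power_bound (R : realType) (x y z p q r : nat) (u : R) :
  (1 < x)%N -> (1 < y)%N -> (1 < z)%N -> (0 < p)%N -> (0 < q)%N -> (0 < r)%N ->
  coprime x y -> coprime x z -> coprime y z -> (x ^ p + y ^ q = z ^ r)%N ->
  u = ln (x * y * z)%:R ->
  ln (ln (z ^ r)%:R) <= u / 3 + 15 * u / ln u.
Proof.
move=> x1 y1 z1 p0 q0 r0 cxy cxz cyz e uE.
rewrite leNgt; apply/negP; set Y := ln (ln _) => hlt.
have pos (a : nat) : (1 < a)%N -> 0 < a%:R :> R by move=> ?; rewrite ltr0n ltnW.
have n8 : (8 <= x * y * z)%N by apply: (@leq_mul 4 2) => //; apply: (@leq_mul 2 2).
have u1 : 1 < u.
  rewrite uE; apply: lt_le_trans (ln3_gt1 R) _; rewrite ler_ln ?posrE ?ltr0n ?(leq_trans _ n8) //.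
  by rewrite ler_nat (leq_trans _ n8).
(* The negated conclusion supplies the lower bound on [Y] that the numerical estimates require. *)
have [W1 _] : 75 / 2 <= Y - u / 3 /\ 300 * u <= (Y - u / 3) ^+ 2.
  by apply: log_quotient_bounds => //; lra.
have Y1 : 75 / 2 <= Y by lra.
have H1 : (1 < z ^ r)%N by rewrite -(exp1n r) ltn_exp2r.
have lnH0 : 0 < ln (z ^ r)%:R :> R by rewrite ln_gt0 // ltr1n.
have eY : expR Y = ln (z ^ r)%:R by rewrite lnK.
pose w := minn x (minn y z).
have w1 : (1 < w)%N by rewrite !leq_min x1 y1.
have [wx wy wz] : [/\ w <= x, w <= y & w <= z]%N.
  by rewrite geq_minl !geq_min !leqnn ?orbT.
have w3 : 3 * ln w%:R <= u.
  rewrite uE mulr_natl -lnXn ?pos // ler_ln ?posrE ?exprn_gt0 ?pos ?ltr0n ?(leq_trans _ n8) //.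
  by rewrite -natrX ler_nat !expnS expn0 muln1 mulnA; apply: leq_mul => //; apply: leq_mul.
(* The squares of [x], [y] and [z] must be at most [2 ^ h]; with this choice [h] is also linear in
   [u]. *)
set h := up_log 2 ((x * y * z) ^ 2).
have n2 : (1 < (x * y * z) ^ 2)%N by rewrite -(exp1n 2) ltn_exp2r // (leq_trans _ n8).
have /andP [hlow hup] := up_log_bounds (isT : 1 < 2)%N n2; rewrite -/h in hlow hup.
have h0 : (0 < h)%N by rewrite up_log_gt0.
have hh : h%:R <= 5 * u.
  have : h.-1%:R * ln 2 <= 2 * u :> R.
    rewrite mulr_natl -lnXn // [2 * u]mulr_natl uE -lnXn ?ltr0n ?(leq_trans _ n8) //.
    rewrite ler_ln ?posrE ?exprn_gt0 ?ltr0n ?(leq_trans _ n8) //.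
    by rewrite -!natrX ler_nat ltnW.
  have := ler_wpM2l (ler0n R h.-1) (ln2_ge R).
  rewrite -(prednK h0) -[X in X%:R <= _]addn1 natrD prednK //; lra.
have hsq a b : (0 < b)%N -> (a * b = x * y * z)%N -> (a ^ 2 <= 2 ^ h)%N.
  by move=> b0 eab; apply: leq_trans hup; rewrite -eab leq_exp2r // leq_pmulr.
have [x0 y0 z0] : [/\ 0 < x, 0 < y & 0 < z]%N by split; apply: ltnW.
pose chi := (Num.truncn (6 * Y)).+1.
have hchi : 6 * Y <= chi%:R <= 6 * Y + 1.
  have Y60 : 0 <= 6 * Y by lra.
  have /andP [t1 t2] := truncn_itv Y60.
  by rewrite (ltW t2) /= /chi -addn1 natrD lerD2r.
have expo a b : (1 < a)%N -> (a ^ b <= z ^ r)%N -> b%:R <= 2 * expR Y.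
  move=> a1 hab; rewrite eY.
  have : b%:R * ln a%:R <= ln (z ^ r)%:R :> R.
    rewrite mulr_natl -lnXn ?pos // -natrX ler_ln ?posrE ?ltr0n ?expn_gt0 ?(ltnW a1) ?z0 //.
    by rewrite ler_nat.
  have : b%:R * (1 / 2) <= b%:R * ln a%:R :> R.
    rewrite ler_wpM2l //; apply: le_trans (ln2_ge R) _.
    by rewrite ler_ln ?posrE ?pos // ler_nat.
  by lra.
have hP : (p + q + r)%N%:R <= 6 * expR Y.
  have A1 := expo x p x1 _; have A2 := expo y q y1 _; have A3 := expo z r z1 (leqnn _).
  rewrite !natrD; have := A1 _; have := A2 _; rewrite -e leq_addr leq_addl.
  by move=> /(_ isT) ? /(_ isT) ?; lra.
have [C1 C2] : (det_dim (2 * w) h chi <= 2 ^ chi)%N /\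
    (2 * box_side (2 * w) h chi * (p + q + r) <= 2 ^ chi)%N.
  apply: (@parameter_conditions R Y) => //; last by lra.
  by rewrite -ler_ln ?posrE ?expR_gt0 ?pos // expRK; lra.
have := fermat_catalan_bound R x1 y1 z1 p0 q0 r0 cxy cxz cyz e (erefl w)
  (hsq x (y * z)%N _ _) (hsq y (x * z)%N _ _) (hsq z (x * y)%N _ _) C1 C2.
rewrite !muln_gt0 x0 y0 z0 => /(_ isT (mulnA _ _ _) isT _ isT (mulnC _ _)).
move=> /(_ ltac:(by rewrite mulnCA mulnA)) hfin.
have : Y <= u / 3 + 15 * u / ln u.
  apply: (loglog_bound u1 hchi hh h0 w1 w3).
  rewrite eY mulr_natl -lnXn ?pos // -natrX ler_ln ?posrE ?ltr0n ?expn_gt0 ?(ltnW w1) ?z0 //.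
  by rewrite ler_nat.
by rewrite leNgt hlt.
Qed.

(** * The radical, coprimality and the final inequality *)

Lemma prod_primes_le (n : nat) : (0 < n)%N -> (\prod_(l <- primes n) l <= n)%N.
Proof.
move=> n0; rewrite {2}(prod_prime_decomp n0) /primes /unzip1 big_map big_seq [leqRHS]big_seq.
apply: leq_prod => -[l k] /mem_prime_decomp [pl k0 _] /=.
by rewrite -{1}[l]expn1 leq_exp2l // prime_gt1.
Qed.

(** An odd prime factor makes the radical exceed e, so that its iterated logarithm is positive. *)
Lemma prod_primes_ge3 (n a : nat) : (0 < n)%N -> (1 < a)%N -> odd a -> (a %| n)%N ->
  (3 <= \prod_(l <- primes n) l)%N.
Proof.
move=> n0 a1 oa an; set l := pdiv a; have pl : prime l by apply: pdiv_prime.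
have la : (l %| a)%N by apply: pdiv_dvd.
have l3 : (2 < l)%N.
  rewrite ltn_neqAle prime_gt1 // andbT; apply: contraTneq oa => l2.
  by rewrite -[odd a]negbK -dvdn2 l2 la.
apply: leq_trans l3 _; apply: dvdn_leq.
  by rewrite big_seq; apply: prodn_cond_gt0 => k; rewrite mem_primes => /and3P [/prime_gt0].
have ln : l \in primes n by rewrite mem_primes pl n0 (dvdn_trans la).
by rewrite (big_rem _ ln) dvdn_mulr.
Qed.

(** By the equation, a prime dividing two of the bases divides the third. *)
Lemma pairwise_coprime_of_sum (a b c p q r : nat) : (0 < p)%N -> (0 < q)%N -> (0 < r)%N ->
  (0 < a)%N -> gcdn (gcdn a b) c = 1%N -> (a ^ p + b ^ q = c ^ r)%N ->
  [/\ coprime a b, coprime a c & coprime b c].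
Proof.
move=> p0 q0 r0 a0 g1 e.
have nodvd l : prime l -> (l %| a)%N -> (l %| b)%N -> (l %| c)%N -> False.
  move=> pl la lb lc; have : (l %| gcdn (gcdn a b) c)%N by rewrite !dvdn_gcd la lb lc.
  by rewrite g1 dvdn1 => /eqP l1; rewrite l1 in pl.
have dvdX l k m : prime l -> (0 < m)%N -> (l %| k ^ m)%N = (l %| k)%N.
  by move=> pl m0; rewrite Euclid_dvdX // m0 andbT.
have cop k m : (forall l, prime l -> (l %| k)%N -> (l %| m)%N -> False) -> coprime k m.
  move=> h; rewrite /coprime eqn_leq gcdn_gt0; apply/andP; split.
    rewrite leqNgt; apply/negP => g2; apply: (h (pdiv (gcdn k m))).
    - exact: pdiv_prime.
    - by apply: dvdn_trans (pdiv_dvd _) (dvdn_gcdl _ _).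
    - by apply: dvdn_trans (pdiv_dvd _) (dvdn_gcdr _ _).
  (* The gcd vanishes only for [k = m = 0], where the prime 2 is a common divisor. *)
  apply: contraT; rewrite negb_or -!eqn0Ngt => /andP [/eqP k0 /eqP m0].
  by exfalso; apply: (h 2%N); rewrite ?k0 ?m0.
split; apply: cop => l pl l1 l2; apply: (nodvd l pl) => //.
- by rewrite -(dvdX _ _ r pl r0) -e dvdn_add // dvdX.
- by rewrite -(dvdX _ _ q pl q0) -(dvdn_addr _ (_ : (l %| a ^ p)%N)) ?e dvdX.
- by rewrite -(dvdX _ _ p pl p0) -(dvdn_addl _ (_ : (l %| b ^ q)%N)) ?e dvdX.
Qed.

Theorem theorem1 (R : realType) (p q r x y z : int)
  (hgcd : gcdz (gcdz x y) z = 1)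
  (hx : 2 <= x) (hy : 2 <= y) (hz : 2 <= z)
  (hp : 3 <= p) (hq : 3 <= q) (hr : 3 <= r)
  (heq : x ^ p + y ^ q = z ^ r) :
  let logc : R := ln (z ^ r)%:~R in
  let G : nat := radical (x * y * z) in
  3 * ln logc / logc * (1 / (1 + 45 / ln (ln (G%:R : R))))
    < 1 / p%:~R + 1 / q%:~R + 1 / r%:~R.
Proof.
case: x hx hgcd heq => [x|//] hx; case: y hy => [y|//] hy; case: z hz => [z|//] hz.
case: p hp => [p|//] hp; case: q hq => [q|//] hq; case: r hr => [r|//] hr hgcd heq.
cbv zeta.
have x1 : (1 < x)%N by rewrite -ltz_nat. have y1 : (1 < y)%N by rewrite -ltz_nat.
have z1 : (1 < z)%N by rewrite -ltz_nat.
have p0 : (0 < p)%N by rewrite (@leq_trans 3). have q0 : (0 < q)%N by rewrite (@leq_trans 3).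
have r0 : (0 < r)%N by rewrite (@leq_trans 3).
have [x0 y0 z0] : [/\ 0 < x, 0 < y & 0 < z]%N by split; apply: ltnW.
have e : (x ^ p + y ^ q = z ^ r)%N.
  by apply/eqP; rewrite -eqz_nat PoszD !Posz_exp; apply/eqP; apply: heq.
have g1 : gcdn (gcdn x y) z = 1%N by case: hgcd.
have [cxy cxz cyz] := pairwise_coprime_of_sum p0 q0 r0 x0 g1 e.
pose u : R := ln (x * y * z)%:R.
have hY := loglog_power_bound x1 y1 z1 p0 q0 r0 cxy cxz cyz e (erefl u).
have -> : (z%:Z ^ r%:Z)%:~R = (z ^ r)%:R :> R by rewrite -exprnP -Posz_exp.
have n0 : (0 < x * y * z)%N by rewrite !muln_gt0 x0 y0 z0.
set G := radical _.
have GE : G = (\prod_(l <- primes (x * y * z)) l)%N by rewrite /G /radical !abszM.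
have G3 : (3 <= G)%N.
  rewrite GE; have [ox|ex] := boolP (odd x).
    by apply: (prod_primes_ge3 n0 x1 ox); rewrite -mulnA dvdn_mulr.
  have oy : odd y.
    apply: contraTT cxy => ey; rewrite /coprime; apply/negP => /eqP g.
    have : (2 %| gcdn x y)%N by rewrite dvdn_gcd !dvdn2 ex ey.
    by rewrite g.
  by apply: (prod_primes_ge3 n0 y1 oy); rewrite mulnAC dvdn_mull.
have Gn : (G <= x * y * z)%N by rewrite GE; apply: prod_primes_le.
have GR : 0 < G%:R :> R by rewrite ltr0n (leq_trans _ G3).
have lnG1 : 1 < ln G%:R :> R.
  by apply: lt_le_trans (ln3_gt1 R) _; rewrite ler_ln ?posrE ?GR ?ltr0n // ler_nat.
have Gu : ln G%:R <= u by rewrite ler_ln ?posrE ?GR ?ltr0n // ler_nat.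
set ll := ln (ln G%:R); have ll0 : 0 < ll by rewrite ln_gt0.
have u1 : 1 < u := lt_le_trans lnG1 Gu.
have ll_le : ll <= ln u by rewrite ler_ln ?posrE ?(lt_trans ltr01).
have H1 : (1 < z ^ r)%N by rewrite -(exp1n r) ltn_exp2r.
set H := ln (z ^ r)%:R in hY *; have H0 : 0 < H by rewrite ln_gt0 // ltr1n.
have part a b : (1 < a)%N -> (0 < b)%N -> (a ^ b <= z ^ r)%N -> ln a%:R / H <= 1 / b%:R :> R.
  move=> a1 b0 hab; rewrite ler_pdivrMr // mulrAC mul1r ler_pdivlMr ?ltr0n //.
  rewrite mulr_natr -lnXn ?ltr0n ?(ltnW a1) // -natrX.
  by rewrite ler_ln ?posrE ?ltr0n ?expn_gt0 ?(ltnW a1) ?z0 // ler_nat.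
(* One of the three estimates must be strict; here it is, since [y ^ q] is positive. *)
have partx : ln x%:R / H < 1 / p%:R :> R.
  rewrite ltr_pdivrMr // mulrAC mul1r ltr_pdivlMr ?ltr0n //.
  rewrite mulr_natr -lnXn ?ltr0n // -natrX.
  rewrite ltr_ln ?posrE ?ltr0n ?expn_gt0 ?x0 ?z0 // ltr_nat -e.
  by rewrite -{1}[(x ^ p)%N]addn0 ltn_add2l expn_gt0 y0.
have uE : u = ln x%:R + ln y%:R + ln z%:R by rewrite /u !natrM !lnM ?posrE ?mulr_gt0 ?ltr0n.
apply: (@le_lt_trans _ _ (u / H)); last first.
  rewrite uE !mulrDl; apply: ltr_leD; first apply: ltr_leD => //.
    by apply: part => //; rewrite -e leq_addl.
  by apply: part.
have D0 : 0 < 1 + 45 / ll by rewrite addr_gt0 // divr_gt0.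
rewrite mulrA mulr1 ler_pdivrMr // [leRHS]mulrAC ler_pM2r ?invr_gt0 //.
(* As [ln G <= u], replacing [ln u] by [ll] only enlarges the error term. *)
have hll : 15 * u / ln u <= 15 * u / ll.
  have lnu0 : 0 < ln u by rewrite ln_gt0.
  by rewrite ler_wpM2l ?lef_pV2 ?posrE // mulr_ge0 // ltW // (lt_trans ltr01).
have -> : u * (1 + 45 / ll) = 3 * (u / 3 + 15 * u / ll) by field; rewrite gt_eqF.
by rewrite ler_pM2l //; apply: le_trans hY _; rewrite lerD2l.
Qed.
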